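(* Let $\mathbb{T}$ be a time scale that is unbounded above and has bounded graininess, let $t_0<t_f$ be points of $\mathbb{T}$, and let $A(t)\in\mathbb{R}^{n\times n}$, $C(t)\in\mathbb{R}^{p\times n}$ be rd-continuous matrix functions on $\mathbb{T}$ with $A$ regressive. The regressive linear system $$x^{\Delta}(t)=A(t)x(t),\quad x(t_0)=x_0,\qquad y(t)=C(t)x(t),$$ is observable on $[t_0,t_f]$ if and only if the $n\times n$ observability Gramian matrix $$\mathscr{G}_{O}(t_0,t_f):=\int_{t_0}^{t_f}\Phi_{A}^T(t,t_0)C^{T}(t)C(t)\Phi_{A}(t,t_0)\,\Delta t$$ is invertible.
   Context: A time scale $\mathbb{T}$ is a nonempty closed subset of $\mathbb{R}$, with forward jump operator $\sigma(t)=\inf\{s\in\mathbb{T}:s>t\}$ and graininess $\mu(t)=\sigma(t)-t$; $f^\Delta$ denotes the delta derivative and $\int f(t)\,\Delta t$ the delta integral. Intervals are understood to be intersected with $\mathbb{T}$. A function is rd-continuous if it is continuous at right-dense points of $\mathbb{T}$ and has finite left limits at left-dense points. $A$ (or the system) is regressive if $I+\mu(t)A(t)$ is invertible for all $t\in\mathbb{T}$. $\Phi_A(t,s)$ is the transition matrix: the unique solution $X(t)$ of $X^\Delta(t)=A(t)X(t)$, $X(s)=I$. The system is observable on $[t_0,t_f]$ if any initial state $x(t_0)=x_0$ is uniquely determined by the corresponding response $y(t)$ for $t\in[t_0,t_f)$. *)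

(* Defs.v *)
From HB Require Import structures.
From mathcomp Require Import all_boot all_order all_algebra.
From mathcomp Require Import all_classical all_reals all_analysis.
Import Order.TTheory GRing.Theory Num.Theory.
Import numFieldNormedType.Exports.

Set Implicit Arguments.
Unset Strict Implicit.
Unset Printing Implicit Defensive.

Local Open Scope classical_set_scope.
Local Open Scope ring_scope.

(** Functions on a time scale [T] are functions on [R] whose values outside [T]
    are never used. [inf] and [sup] return 0 on sets without a greatest lower
    (resp. least upper) bound, so [sigma] has its usual meaning at every point
    of [T] only if [T] is unbounded above; in that case every point of [T] is
    also a point of delta differentiability in the usual sense (T^kappa = T). *)

Definition time_scale (R : realType) (T : set R) : Prop :=
  T !=set0 /\ closed T.

Definition unbounded_above (R : realType) (T : set R) : Prop :=
  ~ has_ubound T.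

Definition sigma (R : realType) (T : set R) (t : R) : R :=
  inf [set s | T s /\ t < s].

Definition rho (R : realType) (T : set R) (t : R) : R :=
  sup [set s | T s /\ s < t].

Definition mu (R : realType) (T : set R) (t : R) : R := sigma T t - t.

Definition bounded_graininess (R : realType) (T : set R) : Prop :=
  exists B : R, forall t, T t -> mu T t <= B.

Definition right_dense (R : realType) (T : set R) (t : R) : Prop :=
  T t /\ sigma T t = t.

(** The second conjunct says that [t] is not the minimum of [T]. *)
Definition left_dense (R : realType) (T : set R) (t : R) : Prop :=
  [/\ T t, exists2 s, T s & s < t & rho T t = t].

Definition rd_continuous (R : realType) (T : set R) (f : R -> R) : Prop :=
  (forall t, right_dense T t -> f s @[s --> within T (nbhs t)] --> f t) /\
  (forall t, left_dense T t ->
     exists l : R, f s @[s --> within T (t^'-)] --> l).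

(** [is_delta_derive T f t d] means that f^Delta(t) exists and equals [d]. *)
Definition is_delta_derive (R : realType) (T : set R) (f : R -> R) (t d : R)
  : Prop :=
  forall e : R, 0 < e ->
    \forall s \near within T (nbhs t),
      `|(f (sigma T t) - f s) - d * (sigma T t - s)| <= e * `|sigma T t - s|.

Definition delta_antiderivative (R : realType) (T : set R) (f F : R -> R)
  : Prop :=
  forall t, T t -> is_delta_derive T F t (f t).

(** The Cauchy delta integral F(b) - F(a), where F is any antiderivative of f
    on [T] (the value does not depend on F when [a] and [b] are in [T]);
    it is 0 by convention when f has no antiderivative. *)
Definition delta_integral (R : realType) (T : set R) (f : R -> R) (a b : R)
  : R :=
  xget 0 [set I | exists2 F, delta_antiderivative T f F & I = F b - F a].

(** For matrix functions all notions are taken entrywise. *)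

Definition mx_rd_continuous (R : realType) (T : set R) (m n : nat)
    (A : R -> 'M[R]_(m, n)) : Prop :=
  forall i j, rd_continuous T (fun t => A t i j).

Definition is_mx_delta_derive (R : realType) (T : set R) (m n : nat)
    (X : R -> 'M[R]_(m, n)) (t : R) (D : 'M[R]_(m, n)) : Prop :=
  forall i j, is_delta_derive T (fun s => X s i j) t (D i j).

Definition mx_delta_integral (R : realType) (T : set R) (m n : nat)
    (X : R -> 'M[R]_(m, n)) (a b : R) : 'M[R]_(m, n) :=
  \matrix_(i, j) delta_integral T (fun t => X t i j) a b.

Definition regressive (R : realType) (T : set R) (n : nat)
    (A : R -> 'M[R]_n) : Prop :=
  forall t, T t -> 1%:M + mu T t *: A t \in unitmx.

(** X^Delta = A X on [T]; used for square matrices and for column vectors. *)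
Definition delta_solution (R : realType) (T : set R) (n m : nat)
    (A : R -> 'M[R]_n) (X : R -> 'M[R]_(n, m)) : Prop :=
  forall t, T t -> is_mx_delta_derive T X t (A t *m X t).

(** Phi_A(t, s): the value at [t] of the solution of X^Delta = A X, X(s) = I.
    A solution is unique only up to its values outside [T], so it is the value
    at [t], and not the function X, that is selected. *)
Definition transition_matrix (R : realType) (T : set R) (n : nat)
    (A : R -> 'M[R]_n) (t s : R) : 'M[R]_n :=
  xget 0 [set M | exists X : R -> 'M[R]_n,
    [/\ delta_solution T A X, X s = 1%:M & M = X t]].

(** [x] is the state and [y] the response of the system started at [x0]. *)
Definition linear_system (R : realType) (T : set R) (n p : nat)
    (A : R -> 'M[R]_n) (C : R -> 'M[R]_(p, n)) (t0 : R) (x0 : 'cV[R]_n)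
    (x : R -> 'cV[R]_n) (y : R -> 'cV[R]_p) : Prop :=
  [/\ delta_solution T A x, x t0 = x0 & forall t, T t -> y t = C t *m x t].

Definition observable (R : realType) (T : set R) (n p : nat)
    (A : R -> 'M[R]_n) (C : R -> 'M[R]_(p, n)) (t0 tf : R) : Prop :=
  forall (x0 x0' : 'cV[R]_n) (x x' : R -> 'cV[R]_n) (y y' : R -> 'cV[R]_p),
    linear_system T A C t0 x0 x y ->
    linear_system T A C t0 x0' x' y' ->
    (forall t, T t -> t0 <= t < tf -> y t = y' t) ->
    x0 = x0'.

Definition observability_gramian (R : realType) (T : set R) (n p : nat)
    (A : R -> 'M[R]_n) (C : R -> 'M[R]_(p, n)) (t0 tf : R) : 'M[R]_n :=
  mx_delta_integral T (fun t =>
    (transition_matrix T A t t0)^T *m (C t)^T *m C t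
      *m transition_matrix T A t t0) t0 tf.

(* Main.v *)
Require Import Defs.
From HB Require Import structures.
From mathcomp Require Import all_boot all_order all_algebra.
From mathcomp Require Import all_classical all_reals all_analysis.
From mathcomp Require Import ring lra.
Import Order.TTheory GRing.Theory Num.Theory.
Import numFieldNormedType.Exports.

Set Implicit Arguments.
Unset Strict Implicit.
Unset Printing Implicit Defensive.

Local Open Scope classical_set_scope.
Local Open Scope ring_scope.

(** The transition matrix is a product integral: for a finite sorted set of points
    of [T], multiply the Euler factors [1 + (q' - q) A(q)] over consecutive points,
    and pass to the limit along an ultrafilter refining the filter of
    finite subsets of [T].  Bounds on Euler products that are uniform in the
    partition survive in the limit and give delta differentiability; the cocycle
    law [Phi u s = Phi u t *m Phi t s] survives as well, and regressivity makes
    every [Phi t s] invertible, hence solvability backwards in time.  If [Z] is a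
    solution, [q |-> Phi b q *m Z q] has zero derivative, which is uniqueness.
    Antiderivatives of rd-continuous functions come from a nilpotent 2 x 2 system.

    With a fundamental solution [X], [X(t0) = 1], the Gramian is [F tf - F t0] for
    an antiderivative [F] of [M = X^T C^T C X].  If [C X z] vanishes on [[t0, tf[]
    then [F z] is constant there and the Gramian kills [z]; conversely, if the
    Gramian kills [z], the nondecreasing function [z^T F z] has equal values at
    [t0] and [tf], so its derivative [|C X z|^2] vanishes on [[t0, tf[]. *)

(** * Entrywise l1 norm of matrices *)

Section MatrixL1Norm.
Context {R : realType}.
Implicit Types m n k : nat.

Definition mxl1 m n (X : 'M[R]_(m, n)) : R := \sum_i \sum_j `|X i j|.

Lemma mxl1_ge0 m n (X : 'M[R]_(m, n)) : 0 <= mxl1 X.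
Proof. by apply: sumr_ge0 => i _; apply: sumr_ge0 => j _. Qed.

Lemma ler_mxl1D m n (X Y : 'M[R]_(m, n)) : mxl1 (X + Y) <= mxl1 X + mxl1 Y.
Proof.
rewrite -big_split; apply: ler_sum => i _; rewrite -big_split.
by apply: ler_sum => j _; rewrite mxE ler_normD.
Qed.

Lemma mxl1Z m n (a : R) (X : 'M[R]_(m, n)) : mxl1 (a *: X) = `|a| * mxl1 X.
Proof.
rewrite mulr_sumr; apply: eq_bigr => i _; rewrite mulr_sumr.
by apply: eq_bigr => j _; rewrite mxE normrM.
Qed.

Lemma mxl1N m n (X : 'M[R]_(m, n)) : mxl1 (- X) = mxl1 X.
Proof. by rewrite -scaleN1r mxl1Z normrN1 mul1r. Qed.

Lemma mxl1_distC m n (X Y : 'M[R]_(m, n)) : mxl1 (X - Y) = mxl1 (Y - X).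
Proof. by rewrite -opprB mxl1N. Qed.

Lemma mxl1_0 m n : mxl1 (0 : 'M[R]_(m, n)) = 0.
Proof. by rewrite -(scale0r 0) mxl1Z normr0 mul0r. Qed.

Lemma ler_entry_mxl1 m n (X : 'M[R]_(m, n)) i j : `|X i j| <= mxl1 X.
Proof.
rewrite /mxl1 (bigD1 i) //= (bigD1 j) //= -addrA lerDl addr_ge0 //.
  exact: sumr_ge0.
by apply: sumr_ge0 => ? _; apply: sumr_ge0.
Qed.

Lemma mxl1_eq0 m n (X : 'M[R]_(m, n)) : mxl1 X <= 0 -> X = 0.
Proof.
move=> X0; apply/matrixP => i j; rewrite mxE; apply/eqP.
by rewrite -normr_le0 (le_trans (ler_entry_mxl1 _ _ _) X0).
Qed.

Lemma ler_mxl1M m n k (X : 'M[R]_(m, n)) (Y : 'M[R]_(n, k)) :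
  mxl1 (X *m Y) <= mxl1 X * mxl1 Y.
Proof.
rewrite mulr_suml; apply: ler_sum => i _.
apply: (@le_trans _ _ (\sum_j \sum_l `|X i l| * `|Y l j|)).
  apply: ler_sum => j _; rewrite mxE (le_trans (ler_norm_sum _ _ _)) //.
  by apply: ler_sum => l _; rewrite normrM.
rewrite exchange_big mulr_suml; apply: ler_sum => l _.
rewrite -mulr_sumr ler_wpM2l // /mxl1 [leRHS](bigD1 l) //= lerDl.
by apply: sumr_ge0 => ? _; apply: sumr_ge0.
Qed.

(** A row [v] of the kernel of [X] equals [- v *m (X - 1%:M)], so
    [mxl1 v <= mxl1 v * mxl1 (X - 1%:M)] forces [v = 0]. *)
Lemma mxl1_lt1_unit n (X : 'M[R]_n) : mxl1 (X - 1%:M) < 1 -> X \in unitmx.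
Proof.
move=> X1; rewrite -row_free_unit -kermx_eq0; apply/eqP/row_matrixP => i.
rewrite row0; set v := row i _.
have vX : v *m X = 0 by rewrite /v -row_mul mulmx_ker row0.
have /mxl1_eq0 : mxl1 v <= 0; last by [].
have : mxl1 v <= mxl1 v * mxl1 (X - 1%:M).
  rewrite -{1}(mxl1N (v)) (le_trans _ (ler_mxl1M _ _)) //.
  by rewrite mulmxBr vX mulmx1 sub0r.
have := mxl1_ge0 v; nra.
Qed.

End MatrixL1Norm.

(** * Induction and monotonicity on time scales *)

Lemma near_within_realP {R : realType} (T : set R) (t : R) (P : R -> Prop) :
  (\forall s \near within T (nbhs t), P s) <->
  exists2 d : R, 0 < d & forall s, T s -> `|s - t| < d -> P s.
Proof.
rewrite near_withinE; split=> [/nbhs_ballP[d d0 dP]|[d d0 dP]].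
  by exists d => // s Ts st; apply: dP => //; rewrite /ball /= distrC.
by apply/nbhs_ballP; exists d => // s /= st Ts; apply: dP; rewrite // distrC.
Qed.

Section TimeScale.
Context {R : realType} (T : set R).
Hypotheses (Tcl : closed T) (Tub : unbounded_above T).

Lemma closed_approx (r : R) :
  (forall d : R, 0 < d -> exists2 s, T s & `|s - r| < d) -> T r.
Proof.
move=> Tr; apply: Tcl => B /nbhs_ballP[d d0 dB].
have [s Ts sr] := Tr _ d0; exists s; split=> //.
by apply: dB; rewrite /ball /= distrC.
Qed.

Lemma unbounded_above_gt (t : R) : exists2 s, T s & t < s.
Proof.
apply: contrapT => H; apply: Tub; exists t => s Ts.
by rewrite leNgt; apply/negP => ts; apply: H; exists s.
Qed.

Let has_inf_right (t : R) : has_inf [set s | T s /\ t < s].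
Proof.
have [s Ts ts] := unbounded_above_gt t.
by split; [exists s | exists t => x [_ /ltW]].
Qed.

Lemma sigma_ge (t : R) : t <= sigma T t.
Proof. by apply: lb_le_inf; [case: (has_inf_right t) | move=> x [_ /ltW]]. Qed.

Lemma sigma_le (t s : R) : T s -> t < s -> sigma T t <= s.
Proof. by move=> Ts ts; apply: ge_inf; [case: (has_inf_right t) | ]. Qed.

Lemma sigma_lt (t : R) (d : R) : 0 < d ->
  exists2 s, T s & t < s < sigma T t + d.
Proof.
move=> d0; have [s [Ts ts] sd] := inf_adherent d0 (has_inf_right t).
by exists s; rewrite // ts.
Qed.

Lemma sigma_in (t : R) : T (sigma T t).
Proof.
apply: closed_approx => d d0; have [s Ts /andP[ts sd]] := sigma_lt t d0.
by exists s => //; have := sigma_le Ts ts; rewrite ltr_norml; lra.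
Qed.

Lemma right_dense_or_scattered (t : R) :
  T t -> right_dense T t \/ t < sigma T t.
Proof.
by move=> Tt; have := sigma_ge t; rewrite le_eqVlt => /predU1P[e|]; [left|right].
Qed.

Lemma right_dense_approx (t d : R) : right_dense T t -> 0 < d ->
  exists2 s, T s & t < s < t + d.
Proof. by move=> [_ st] /(sigma_lt t); rewrite st. Qed.

Lemma left_dense_approx (t d : R) : left_dense T t -> 0 < d ->
  exists2 s, T s & t - d < s < t.
Proof.
move=> [Tt [q Tq qt] rt] d0.
have : has_sup [set s | T s /\ s < t].
  by split; [exists q | exists t => x [_ /ltW]].
move=> /(sup_adherent d0)[s [Ts st]]; rewrite -/(rho T t) rt => ds.
by exists s; rewrite // ds.
Qed.

(** The point [q] is [rho T t], which lies in [T] by closedness. The bound [a <= q] lets an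
    induction hypothesis on [[a, t[] be used at [q]. *)
Lemma left_dense_or_scattered (a t : R) : T a -> T t -> a < t ->
  left_dense T t \/ exists q, [/\ T q, a <= q < t & sigma T q = t].
Proof.
move=> Ta Tt at_.
have hs : has_sup [set s | T s /\ s < t].
  by split; [exists a | exists t => x [_ /ltW]].
have rt : rho T t <= t by apply: ge_sup; [case: hs | move=> x [_ /ltW]].
have rub s : T s -> s < t -> s <= rho T t.
  by move=> Ts st; apply: sup_upper_bound.
move: rt; rewrite le_eqVlt => /predU1P[e|rt]; first by left; split=> //; exists a.
right; exists (rho T t).
have Tr : T (rho T t).
  apply: closed_approx => d d0; have [s [Ts st] ds] := sup_adherent d0 hs.
  exists s => //; have := rub _ Ts st; move: ds.
  by rewrite -/(rho T t) ltr_norml; lra.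
split => //; first by rewrite rub.
apply/eqP; rewrite eq_le sigma_le //= leNgt; apply/negP => lt.
have [|s Ts /andP[rs st]] := @sigma_lt (rho T t) (t - sigma T (rho T t)).
  by rewrite subr_gt0.
by have := rub _ Ts; move: rs st; lra.
Qed.

(* The Bohner--Peterson induction principle on [T `&` [a, +oo[]. *)
Lemma time_scale_ind (a : R) (P : R -> Prop) : T a -> P a ->
  (forall t, T t -> a <= t -> t < sigma T t -> P t -> P (sigma T t)) ->
  (forall t, right_dense T t -> a <= t -> P t ->
    exists2 d : R, 0 < d & forall s, T s -> t < s < t + d -> P s) ->
  (forall t, left_dense T t -> a < t ->
    (forall s, T s -> a <= s < t -> P s) -> P t) ->
  forall t, T t -> a <= t -> P t.
Proof.
move=> Ta Pa Psigma Prd Pld t Tt at_; apply: contrapT => nPt.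
(* With [r] the infimum of the counterexamples, the property holds before [r], hence at [r], hence
   just after [r], a contradiction. *)
pose S := [set s | [/\ T s, a <= s & ~ P s]].
have hS : has_inf S by split; [exists t | exists a => x []].
pose r := inf S.
have rlb s : S s -> r <= s by move=> Ss; apply: ge_inf => //; case: hS.
have ar : a <= r by apply: lb_le_inf; [case: hS | move=> x []].
have Tr : T r.
  apply: closed_approx => d d0; have [s Ss sd] := inf_adherent d0 hS.
  case: (Ss) => Ts _ _; exists s => //.
  by have := rlb _ Ss; move: sd; rewrite -/r ltr_norml; lra.
have Pbelow s : T s -> a <= s < r -> P s.
  move=> Ts /andP[as_ sr]; apply: contrapT => nPs.
  by have := rlb s (And3 Ts as_ nPs); rewrite leNgt sr.
have Pr : P r.
  move: (ar); rewrite le_eqVlt => /predU1P[<- //|ar'].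
  have [ld|[q [Tq /andP[aq qr] sqr]]] := left_dense_or_scattered Ta Tr ar'.
    exact: Pld.
  rewrite -sqr; apply: Psigma => //; first by rewrite sqr.
  by apply: Pbelow; rewrite ?aq.
have above u : r < u -> (forall s, T s -> r < s < u -> P s) -> False.
  move=> ru Pu; have [|s Ss su] := @inf_adherent _ S (u - r) _ hS.
    by rewrite subr_gt0.
  have [Ts as_ nPs] := Ss; apply: nPs.
  have := rlb _ Ss; rewrite le_eqVlt => /predU1P[<- //|rs]; apply: Pu => //.
  by move: su; rewrite -/r rs; lra.
have [rd|rs] := right_dense_or_scattered Tr.
  have [d d0 dP] := Prd _ rd ar Pr.
  by apply: (above (r + d)) => //; rewrite ltrDl.
by apply: (above _ rs) => s Ts /andP[/(sigma_le Ts)]; lra.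
Qed.

(* Only one-sided information is needed: a lower right derivative [>= 0] and
   lower semicontinuity from the left. *)
Lemma time_scale_nondecreasing (a b : R) (h : R -> R) :
  T a -> T b -> a <= b ->
  (forall t, T t -> a <= t < b -> t < sigma T t -> h t <= h (sigma T t)) ->
  (forall t, right_dense T t -> a <= t < b -> forall e : R, 0 < e ->
    exists2 d : R, 0 < d &
      forall s, T s -> t < s < t + d -> s <= b -> h t - e * (s - t) <= h s) ->
  (forall t, left_dense T t -> a < t <= b -> forall e : R, 0 < e ->
    exists2 d : R, 0 < d &
      forall s, T s -> t - d < s < t -> a <= s -> h s - e <= h t) ->
  h a <= h b.
Proof.
move=> Ta Tb ab hsc hrd hld.
(* A slack of slope [e] absorbs the error of the right-dense hypothesis, so the inequality can be
   propagated by induction. *)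
have key e : 0 < e -> h a - e * (b - a) <= h b.
  move=> e0; pose P t := t <= b -> h a - e * (t - a) <= h t.
  suff : P b by apply.
  apply: (@time_scale_ind a) => //; rewrite /P; first by rewrite subrr mulr0 subr0.
  - move=> t Tt at_ ts IH sb; have tb : t < b by exact: lt_le_trans sb.
    have := hsc t Tt; rewrite at_ tb => /(_ isT ts); have := IH (ltW tb).
    by nra.
  - move=> t rd at_ IH; have [tb|bt] := ltP t b; last first.
      by exists 1 => // s _ ? ?; exfalso; lra.
    have [|d d0 dP] := hrd t rd _ e e0; first by rewrite at_.
    exists d => // s Ts tsd sb; have := dP s Ts tsd sb; have := IH (ltW tb); nra.
  - move=> t ld at_ IH tb; apply/ler_addgt0Pr => n n0.
    have [|d d0 dP] := hld t ld _ n n0; first by rewrite at_.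
    have m0 : 0 < Num.min d (t - a) by rewrite lt_min d0 subr_gt0.
    have [s Ts] := left_dense_approx ld m0.
    have : Num.min d (t - a) <= t - a by rewrite ge_min lexx orbT.
    have : Num.min d (t - a) <= d by rewrite ge_min lexx.
    move=> md mta ms; have := dP s Ts; have := IH s Ts.
    have -> : a <= s < t by lra.
    have -> : t - d < s < t by lra.
    have -> : a <= s by lra.
    by move=> /(_ isT) + /(_ isT isT) => /(_ (ltac:(lra))); nra.
(* Slope [e / (b - a + 1)] loses at most [e] over the interval; the [1] keeps the denominator
   positive when [a = b]. *)
apply/ler_addgt0Pr => e e0; have c0 : 0 < b - a + 1 by lra.
have := key _ (divr_gt0 e0 c0).
suff : e / (b - a + 1) * (b - a) <= e by lra.
by rewrite mulrAC ler_pdivrMr // ler_wpM2l ?ltW //; lra.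
Qed.

End TimeScale.

(** * Euler products *)

Lemma cvg_finsum {R : realType} (I : Type) (F : set_system I) {FF : Filter F}
    (J : finType) (f : J -> I -> R) (l : J -> R) :
  (forall j, f j x @[x --> F] --> l j) ->
  \sum_j f j x @[x --> F] --> \sum_j l j.
Proof. by move=> fl; apply: cvg_big => //; exact: add_continuous. Qed.

Section MatrixLimits.
Context {R : realType} {I : Type} (F : set_system I) {FF : ProperFilter F}.

Definition mx_cvg m n (X : I -> 'M[R]_(m, n)) (L : 'M[R]_(m, n)) :=
  forall i j, X x i j @[x --> F] --> L i j.

Lemma mx_cvgM m n k (X : I -> 'M[R]_(m, n)) (Y : I -> 'M[R]_(n, k)) L M :
  mx_cvg X L -> mx_cvg Y M -> mx_cvg (fun x => X x *m Y x) (L *m M).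
Proof.
move=> XL YM i j; rewrite mxE; under eq_fun do rewrite mxE.
by apply: cvg_finsum => l; apply: cvgM.
Qed.

Lemma mx_cvg_unique m n (X : I -> 'M[R]_(m, n)) L M :
  mx_cvg X L -> (\forall x \near F, X x = M) -> L = M.
Proof.
move=> XL XM; apply/matrixP => i j; apply: (cvg_unique _ (XL i j)) => //.
by apply: cvg_near_cst; apply: filterS XM => x ->.
Qed.

Lemma mx_cvg_near_unique m n (X Y : I -> 'M[R]_(m, n)) L M :
  mx_cvg X L -> mx_cvg Y M -> (\forall x \near F, X x = Y x) -> L = M.
Proof.
move=> XL YM XY; apply/matrixP => i j; apply: (cvg_unique _ (XL i j)) => //.
by apply: cvg_trans (YM i j); apply: near_eq_cvg; apply: filterS XY => x ->.
Qed.

Lemma mx_cvg_mxl1_le m n (X : I -> 'M[R]_(m, n)) L B (c : R) :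
  mx_cvg X L -> (\forall x \near F, mxl1 (X x - B) <= c) -> mxl1 (L - B) <= c.
Proof.
move=> XL; apply: (@cvgr_to_le _ _ _ _ (fun x => mxl1 (X x - B))).
apply: cvg_finsum => i; apply: cvg_finsum => j.
rewrite mxE; under eq_fun do rewrite mxE.
by apply: cvg_norm; apply: cvgD => //; apply: cvg_cst.
Qed.

End MatrixLimits.

(** The image ultrafilter contains the compact segment [[- M, M]], so it converges. *)
Lemma ultra_bounded_cvg {R : realType} (I : Type) (U : set_system I)
    (UU : UltraFilter U) (f : I -> R) (M : R) :
  (\forall x \near U, `|f x| <= M) -> cvg (f x @[x --> U]).
Proof.
move=> fM; have := @segment_compact R (- M) M; rewrite compact_ultra => cpt.
have UfU : UltraFilter (f x @[x --> U]).
  split=> [|G GP UG]; first exact: fmap_proper_filter.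
  rewrite predeqE => A; split=> [GA|]; last exact: UG.
  have [//|UnA] := in_ultra_setVsetC (f @^-1` A) UU.
  have /filter_ex[x [] //] : G (A `&` ~` A) by apply: filterI => //; exact: UG.
have [|p [_ fp]] := cpt _ UfU; last by apply/cvg_ex; exists p.
by apply: filterS fM => x /=; rewrite in_itv /= ler_norml.
Qed.

Section EulerProducts.
Context {R : realType} (n : nat) (A : R -> 'M[R]_n).

(** Each step takes [A] at its left endpoint, and later factors stand on the left, in the order of
    composition. *)
Fixpoint euler (s : R) (l : seq R) : 'M[R]_n :=
  if l is q :: l' then euler q l' *m (1%:M + (q - s) *: A s) else 1%:M.

Lemma euler_cat s l1 l2 :
  euler s (l1 ++ l2) = euler (last s l1) l2 *m euler s l1.
Proof.
by elim: l1 s => [|q l1 IH] s /=; rewrite ?mulmx1 // IH mulmxA.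
Qed.

Lemma path_lt_le_last (s : R) l : path <%R s l ->
  forall p, p \in s :: l -> p <= last s l.
Proof.
elim: l s => [|q l IH] s /=; first by move=> _ p; rewrite inE => /eqP->.
move=> /andP[sq ql] p; rewrite inE => /predU1P[->|]; last exact: IH.
by apply: (le_trans (ltW sq)); apply: IH => //; rewrite mem_head.
Qed.

(** With [h] the first step and [E] the product of the other factors, the error is [(E - 1%:M) + (E
    - 1%:M) *m (h *: A s) + h *: A s]; then [1 + K * h <= expR (K * h)] closes the induction. The
    bound sees the end points only. *)
Lemma euler_bound (K s : R) l : path <%R s l ->
  (forall p, p \in s :: l -> mxl1 (A p) <= K) ->
  mxl1 (euler s l - 1%:M) <= expR (K * (last s l - s)) - 1.
Proof.
elim: l s => [|q l IH] s /=; first by rewrite !subrr mulr0 expR0 subrr mxl1_0.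
move=> /andP[sq ql] AK; have {IH} := IH q ql.
have h0 : 0 < q - s by rewrite subr_gt0.
have AsK : mxl1 (A s) <= K by apply: AK; rewrite mem_head.
move=> /(_ (fun p pl => AK p (mem_behead (s := s :: q :: l) pl))).
set E := euler q l; set t := last q l; set h := q - s.
set e := expR (K * (t - q)) => Ee.
have -> : E *m (1%:M + h *: A s) - 1%:M =
    (E - 1%:M) + ((E - 1%:M) *m (h *: A s) + h *: A s).
  by rewrite mulmxDr mulmx1 mulmxBl mul1mx subrK addrAC.
apply: (le_trans (ler_mxl1D _ _)).
have := ler_mxl1D ((E - 1%:M) *m (h *: A s)) (h *: A s).
have := ler_mxl1M (E - 1%:M) (h *: A s).
rewrite mxl1Z (gtr0_norm h0).
have -> : t - s = (t - q) + h by rewrite /h addrA subrK.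
rewrite mulrDr expRD -/e.
have := expR_ge1Dx (K * h); have := expR_gt0 (K * (t - q)).
have := mxl1_ge0 (A s); have := mxl1_ge0 (E - 1%:M); rewrite -/e -/h in h0 *.
set a := mxl1 (A s) in AsK *; set x := mxl1 (E - 1%:M) in Ee *.
move=> x0 a0 e0 eh m1 m2.
have ha : h * a <= h * K by rewrite ler_wpM2l // ltW.
have xha : x * (h * a) <= (e - 1) * (h * K).
  by apply: ler_pM => //; apply: mulr_ge0 => //; apply: ltW.
have : e * (1 + K * h) <= e * expR (K * h) by rewrite ler_wpM2l // ltW.
by move: m1 m2 ha xha Ee; lra.
Qed.

(** The error telescopes: a first step of length [h] adds [h *: ((E - 1%:M) *m A s + (A s - B))],
    with [E] the product of the other factors, and [w] bounds [E - 1%:M]. *)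
Lemma euler_taylor (B : 'M[R]_n) (K e w s : R) l : path <%R s l ->
  (forall p, p \in s :: l -> mxl1 (A p) <= K /\ mxl1 (A p - B) <= e) ->
  expR (K * (last s l - s)) - 1 <= w ->
  mxl1 (euler s l - (1%:M + (last s l - s) *: B)) <=
    (w * K + e) * (last s l - s).
Proof.
elim: l s => [|q l IH] s /=.
  by move=> _ _ _; rewrite subrr mulr0 scale0r addr0 subrr mxl1_0.
move=> /andP[sq ql] AK; have {IH} := IH q ql.
have h0 : 0 < q - s by rewrite subr_gt0.
have [AsK AsB] := AK s (mem_head _ _).
have AK' p pl := AK p (mem_behead (s := s :: q :: l) pl).
have K0 : 0 <= K := le_trans (mxl1_ge0 _) AsK.
move=> /(_ AK'); have := euler_bound ql (fun p pl => proj1 (AK' p pl)).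
set E := euler q l; set t := last q l; set h := q - s => b IH tw.
have tqs : expR (K * (t - q)) <= expR (K * (t - s)).
  by rewrite ler_expR ler_wpM2l // lerD2l lerN2 ltW.
have {}IH := IH (le_trans (lerB tqs (lexx 1)) tw).
have -> : E *m (1%:M + h *: A s) - (1%:M + (t - s) *: B) =
    (E - (1%:M + (t - q) *: B)) + h *: ((E - 1%:M) *m A s + (A s - B)).
  have -> : (E - 1%:M) *m A s + (A s - B) = E *m A s - B.
    by rewrite mulmxBl mul1mx addrA subrK.
  have -> : t - s = (t - q) + h by rewrite /h addrA subrK.
  rewrite mulmxDr mulmx1 -scalemxAr [(_ + h) *: B]scalerDl scalerBr.
  by rewrite [_ + (_ *: B + _)]addrA opprD addrACA.
apply: (le_trans (ler_mxl1D _ _)); rewrite mxl1Z (gtr0_norm h0).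
have := ler_mxl1D ((E - 1%:M) *m A s) (A s - B).
have := ler_mxl1M (E - 1%:M) (A s).
have : mxl1 (E - 1%:M) * mxl1 (A s) <= w * K.
  apply: ler_pM => //; try exact: mxl1_ge0.
  by apply: (le_trans b); apply: le_trans tw; rewrite lerB.
move=> m1 m2 m3; have : mxl1 ((E - 1%:M) *m A s + (A s - B)) <= w * K + e.
  by move: m1 m2 m3 AsB; lra.
have -> : t - s = (t - q) + h by rewrite /h addrA subrK.
move=> m4; rewrite mulrDr; apply: lerD => //.
by rewrite mulrC ler_wpM2r // ltW.
Qed.

(** The left end is excluded because [euler] takes its starting point separately. *)
Definition part (P : seq R) (s t : R) := [seq q <- P | s < q <= t].

Lemma mem_part P s t q : (q \in part P s t) = (s < q <= t) && (q \in P).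
Proof. by rewrite mem_filter. Qed.

Lemma path_part P s t : sorted <%R P -> path <%R s (part P s t).
Proof.
move=> Ps; rewrite lt_path_sortedE sorted_filter ?andbT //; last exact: lt_trans.
by apply/allP => q; rewrite mem_part => /andP[/andP[]].
Qed.

Lemma last_part P s t : sorted <%R P -> t \in P -> s <= t ->
  last s (part P s t) = t.
Proof.
move=> Ps tP st; have pp := path_part s t Ps.
apply/eqP; rewrite eq_le; apply/andP; split.
  have := mem_last s (part P s t); rewrite inE mem_part.
  by case/predU1P => [->//|/andP[/andP[]]].
apply: path_lt_le_last => //; rewrite inE mem_part tP lexx !andbT.
by rewrite eq_sym -le_eqVlt.
Qed.

Lemma part_cat P s t u : sorted <%R P -> t \in P -> s <= t -> t <= u ->
  part P s u = part P s t ++ part P t u.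
Proof.
move=> Ps tP st tu; apply: lt_sorted_eq.
- exact: path_sorted (path_part s u Ps).
- apply: (@path_sorted _ _ s); rewrite cat_path path_part //= last_part //.
  exact: path_part.
- move=> q; rewrite mem_cat !mem_part -andb_orl; congr (_ && _).
  by apply/idP/idP; [case: (leP q t) | ]; lra.
Qed.

End EulerProducts.

(** * The transition matrix as an ultrafilter limit *)

Section FinitePartitions.
Context {R : realType} (T : set R).

(** Along this filter a partition eventually contains any prescribed finite set of points of [T]. *)
Definition finite_partitions : set_system (seq R) :=
  filter_from [set D : seq R | forall x, x \in D -> T x]
    (fun D => [set P | [/\ sorted <%R P, forall x, x \in P -> T x &
                           {subset D <= P}]]).

Lemma finite_partitions_filter : ProperFilter finite_partitions.
Proof.
apply: filter_from_proper; first apply: filter_from_filter.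
- by exists [::] => x; rewrite inE.
- move=> D E DT ET; exists (D ++ E).
    by move=> x; rewrite mem_cat => /orP[/DT|/ET].
  by move=> P [Ps PT DEP]; split; split=> // x xD; apply: DEP;
    rewrite mem_cat xD ?orbT.
- move=> D DT; exists (sort <=%R (undup D)); split.
  + by rewrite sort_lt_sorted undup_uniq.
  + by move=> x; rewrite mem_sort mem_undup => /DT.
  + by move=> x; rewrite mem_sort mem_undup.
Qed.

Lemma finite_partitions_near (D : seq R) (Q : seq R -> Prop) :
  (forall x, x \in D -> T x) ->
  (forall P, sorted <%R P -> (forall x, x \in P -> T x) ->
    {subset D <= P} -> Q P) ->
  finite_partitions Q.
Proof. by move=> DT DQ; exists D => // P [Ps PT DP]; exact: DQ. Qed.

End FinitePartitions.

Section TransitionMatrix.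
Context {R : realType} (T : set R).
Hypotheses (Tcl : closed T) (Tub : unbounded_above T).
Context (n : nat) (A : R -> 'M[R]_n).
Hypothesis Abd : forall t, T t ->
  exists K : R, \forall s \near within T (nbhs t), mxl1 (A s) <= K.

(** Time-scale induction in place of compactness: the bound grows by the value at [sigma T t] across
    a gap, and by a local bound at a dense point. *)
Lemma bounded_on_segment (a b : R) : T a -> T b -> a <= b ->
  exists K : R, forall s, T s -> a <= s <= b -> mxl1 (A s) <= K.
Proof.
move=> Ta; move: b; apply: (time_scale_ind Tcl Tub Ta).
- exists (mxl1 (A a)) => s _ /andP[as_ sa].
  by have -> : s = a by apply/eqP; rewrite eq_le as_ sa.
- move=> t Tt at_ ts [K HK]; exists (Num.max K (mxl1 (A (sigma T t)))) => s Ts.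
  move=> /andP[as_ ss]; rewrite le_max; have [st|st] := leP s t.
    by rewrite HK // as_.
  have -> : s = sigma T t by apply/eqP; rewrite eq_le ss sigma_le.
  by rewrite lexx orbT.
- move=> t [Tt _] at_ [K HK]; have [K' /near_within_realP[d d0 dK']] := Abd Tt.
  exists d => // u Tu /andP[tu ud]; exists (Num.max K K') => s Ts /andP[as_ su].
  rewrite le_max; have [st|st] := leP s t; first by rewrite HK // as_.
  by rewrite (dK' s) ?orbT // ltr_norml; lra.
- move=> t ld at_ IH; case: (ld) => Tt _ _.
  have [K' /near_within_realP[d d0 dK']] := Abd Tt.
  have m0 : 0 < Num.min d (t - a) by rewrite lt_min d0 subr_gt0.
  have [q Tq] := left_dense_approx ld m0.
  rewrite ltrBlDr -ltrBlDl lt_min => /andP[/andP[tqd tqa] qt].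
  have [|K HK] := IH q Tq; first by lra.
  exists (Num.max K K') => s Ts /andP[as_ st]; rewrite le_max.
  have [sq|sq] := leP s q; first by rewrite HK // as_.
  by rewrite (dK' s) ?orbT // ltr_norml; lra.
Qed.

Context (U : set_system (seq R)) {UU : UltraFilter U}.
Hypothesis TU : finite_partitions T `<=` U.

Let near_partition (D : seq R) (Q : seq R -> Prop) :
  (forall x, x \in D -> T x) ->
  (forall P, sorted <%R P -> (forall x, x \in P -> T x) ->
    {subset D <= P} -> Q P) ->
  \forall P \near U, Q P.
Proof. by move=> DT DQ; apply: TU; apply: finite_partitions_near DQ. Qed.

(* The product integral of [A], as a limit of Euler products along an
   ultrafilter: convergence is free, and every bound on the Euler products that
   is uniform in the partition survives. *)
Definition transition (t s : R) : 'M[R]_n :=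
  \matrix_(i, j) lim (euler A s (part P s t) i j @[P --> U]).

Let near_pair (s t : R) (Q : seq R -> Prop) : T s -> T t ->
  (forall P, sorted <%R P -> (forall x, x \in P -> T x) ->
    s \in P -> t \in P -> Q P) ->
  \forall P \near U, Q P.
Proof.
move=> Ts Tt HQ; apply: (@near_partition [:: s; t]) => [x|P Ps PT DP].
  by rewrite !inE => /orP[]/eqP->.
by apply: HQ => //; apply: DP; rewrite !inE eqxx ?orbT.
Qed.

Lemma near_euler_bound (K s t : R) : T s -> T t -> s <= t ->
  (forall q, T q -> s <= q <= t -> mxl1 (A q) <= K) ->
  \forall P \near U,
    mxl1 (euler A s (part P s t) - 1%:M) <= expR (K * (t - s)) - 1.
Proof.
move=> Ts Tt st AK; apply: (near_pair Ts Tt) => P Ps PT sP tP.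
rewrite -[X in X - s](last_part Ps tP st); apply: euler_bound.
  exact: path_part.
move=> q; rewrite inE mem_part => /predU1P[->|/andP[/andP[sq qt] /PT Tq]].
  by apply: AK; rewrite ?lexx.
by apply: AK; rewrite ?(ltW sq).
Qed.

Lemma transition_cvg (s t : R) : T s -> T t -> s <= t ->
  mx_cvg U (fun P => euler A s (part P s t)) (transition t s).
Proof.
move=> Ts Tt st i j; rewrite mxE.
have [K AK] := bounded_on_segment Ts Tt st.
apply: (@ultra_bounded_cvg _ _ _ _ _ (expR (K * (t - s)) - 1 + `|1%:M i j|)).
apply: filterS (near_euler_bound Ts Tt st AK) => P HP.
set E := euler _ _ _ in HP *.
have -> : E i j = (E - 1%:M) i j + 1%:M i j by rewrite !mxE subrK.
rewrite (le_trans (ler_normD _ _)) // lerD2r.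
by rewrite (le_trans (ler_entry_mxl1 _ _ _)).
Qed.

Lemma transition_id (s : R) : T s -> transition s s = 1%:M.
Proof.
move=> Ts; apply: mx_cvg_unique (transition_cvg Ts Ts (lexx s)) _.
apply: (near_pair Ts Ts) => P _ _ _ _.
suff -> : part P s s = [::] by [].
apply/eqP; rewrite -[_ == _]negbK -has_filter; apply/hasPn => q _.
by apply/negP => /=; lra.
Qed.

(** Once [t] belongs to [P], the Euler product splits exactly at [t], and products pass to the
    limit. *)
Lemma transition_mul (s t u : R) : T s -> T t -> T u -> s <= t -> t <= u ->
  transition u s = transition u t *m transition t s.
Proof.
move=> Ts Tt Tu st tu.
apply: mx_cvg_near_unique (transition_cvg Ts Tu (le_trans st tu)) _ _.
  exact: mx_cvgM (transition_cvg Tt Tu tu) (transition_cvg Ts Tt st).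
apply: (near_pair Ts Tt) => P Ps PT sP tP.
by rewrite (part_cat Ps tP st tu) euler_cat last_part.
Qed.

(** Partitions containing [sigma T t] have no other point in []t, sigma T t]], so the Euler product
    is eventually constant. *)
Lemma transition_sigma (t : R) : T t -> t < sigma T t ->
  transition (sigma T t) t = 1%:M + mu T t *: A t.
Proof.
move=> Tt ts; have Ts : T (sigma T t) by exact: sigma_in.
apply: mx_cvg_unique (transition_cvg Tt Ts (ltW ts)) _.
apply: (near_pair Tt Ts) => P Ps PT tP sP.
suff -> : part P t (sigma T t) = [:: sigma T t] by rewrite /= mul1mx.
apply: lt_sorted_eq => //; first exact: path_sorted (path_part _ _ Ps).
move=> q; rewrite mem_part inE; apply/andP/eqP => [[/andP[tq qs] /PT Tq]|->].
  by apply/eqP; rewrite eq_le qs sigma_le.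
by rewrite ts lexx.
Qed.

Lemma transition_bound (K s t : R) : T s -> T t -> s <= t ->
  (forall q, T q -> s <= q <= t -> mxl1 (A q) <= K) ->
  mxl1 (transition t s - 1%:M) <= expR (K * (t - s)) - 1.
Proof.
move=> Ts Tt st AK; apply: (mx_cvg_mxl1_le (transition_cvg Ts Tt st)).
exact: near_euler_bound.
Qed.

Lemma transition_taylor (B : 'M[R]_n) (K e w s t : R) : T s -> T t -> s <= t ->
  (forall q, T q -> s <= q <= t -> mxl1 (A q) <= K /\ mxl1 (A q - B) <= e) ->
  expR (K * (t - s)) - 1 <= w ->
  mxl1 (transition t s - (1%:M + (t - s) *: B)) <= (w * K + e) * (t - s).
Proof.
move=> Ts Tt st AK tw; apply: (mx_cvg_mxl1_le (transition_cvg Ts Tt st)).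
apply: (near_pair Ts Tt) => P Ps PT sP tP.
rewrite -[in X in _ - X](last_part Ps tP st) -[in leRHS](last_part Ps tP st).
apply: euler_taylor; [exact: path_part| |by rewrite last_part].
move=> q; rewrite inE mem_part => /predU1P[->|/andP[/andP[sq qt] /PT Tq]].
  by apply: AK; rewrite ?lexx.
by apply: AK; rewrite ?(ltW sq).
Qed.

End TransitionMatrix.

(** * Delta differentiability of matrix functions *)

Section DeltaDerivative.
Context {R : realType} (T : set R).
Hypotheses (Tcl : closed T) (Tub : unbounded_above T).

(** The derivative condition is tested at [s = t], where it bounds the defect by [e * mu T t] for
    every [e > 0]. *)
Lemma is_delta_derive_sigma (f : R -> R) (t d : R) : T t ->
  is_delta_derive T f t d -> f (sigma T t) = f t + mu T t * d.
Proof.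
move=> Tt fd; apply/eqP; rewrite -subr_eq0 -normr_le0; apply/ler_addgt0Pr => e e0.
have s0 : 0 <= sigma T t - t by rewrite subr_ge0 sigma_ge.
have e1 : 0 < e / (sigma T t - t + 1) by apply: divr_gt0 => //; lra.
have /near_within_realP[r r0 /(_ t Tt)] := fd _ e1.
rewrite subrr normr0 r0 => /(_ isT); rewrite (ger0_norm s0) /mu opprD addrA.
rewrite [_ * d]mulrC => /le_trans; apply; rewrite add0r.
rewrite mulrAC ler_pdivrMr; last by lra.
by rewrite ler_wpM2l ?ltW //; lra.
Qed.

Lemma mx_delta_deriveP m n (X : R -> 'M[R]_(m, n)) (t : R) D : T t ->
  is_mx_delta_derive T X t D <->
  X (sigma T t) = X t + mu T t *: D /\
  forall e : R, 0 < e -> exists2 d : R, 0 < d & forall s, T s -> `|s - t| < d ->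
    mxl1 (X s - X t - (s - t) *: D) <= e * `|sigma T t - s|.
Proof.
move=> Tt; split=> [XD|[Xs XD] i j e e0].
  have Xs : X (sigma T t) = X t + mu T t *: D.
    apply/matrixP => i j; rewrite !mxE.
    exact: (is_delta_derive_sigma Tt (XD i j)).
  split=> // e e0; apply/near_within_realP.
  have mn0 : 0 < (m * n)%:R + 1 :> R by rewrite ltr_wpDl.
  have c0 : 0 < e / ((m * n)%:R + 1) by exact: divr_gt0.
  have : \forall s \near within T (nbhs t), forall i j,
      `|X (sigma T t) i j - X s i j - D i j * (sigma T t - s)| <=
        e / ((m * n)%:R + 1) * `|sigma T t - s|.
    by apply: filter_forall => i; apply: filter_forall => j; exact: XD.
  apply: filterS => s Hs; rewrite /mxl1.
  apply: (@le_trans _ _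
    (\sum_(i < m) \sum_(j < n) e / ((m * n)%:R + 1) * `|sigma T t - s|)).
    apply: ler_sum => i _; apply: ler_sum => j _; have := Hs i j.
    rewrite Xs !mxE -normrN /mu; set v := D i j; congr (_ <= _).
    by congr `|_|; ring.
  rewrite !sumr_const !card_ord -mulrnA -[leLHS]mulr_natl mulrA ler_wpM2r //.
  rewrite mulrCA; apply: ler_piMr; first exact: ltW.
  by rewrite ler_pdivrMr // mul1r mulnC lerDl.
have [d d0 Hd] := XD e e0; apply/near_within_realP; exists d => // s Ts sd.
apply: le_trans (Hd s Ts sd); apply: le_trans (ler_entry_mxl1 _ i j).
rewrite Xs !mxE -normrN /mu; set v := D i j; rewrite le_eqVlt; apply/orP; left.
by apply/eqP; congr `|_|; ring.
Qed.

Lemma mx_delta_derive_continuous m n (X : R -> 'M[R]_(m, n)) (t : R) D : T t ->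
  is_mx_delta_derive T X t D ->
  forall e : R, 0 < e -> exists2 d : R, 0 < d & forall s, T s -> `|s - t| < d ->
    mxl1 (X s - X t) <= e.
Proof.
move=> Tt /(mx_delta_deriveP _ _ Tt)[_ XD] e e0.
have s0 := sigma_ge Tub t.
have e1 : 0 < e / (2 * (sigma T t - t + 1)) by apply: divr_gt0 => //; lra.
have e2 : 0 < e / (2 * (mxl1 D + 1)).
  by apply: divr_gt0 => //; have := mxl1_ge0 D; lra.
have [d d0 Hd] := XD _ e1.
exists (Num.min d (Num.min 1 (e / (2 * (mxl1 D + 1))))).
  by rewrite !lt_min d0 ltr01.
move=> s Ts; rewrite !lt_min => /and3P[sd s1 s2].
have -> : X s - X t = (X s - X t - (s - t) *: D) + (s - t) *: D by rewrite subrK.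
apply: (le_trans (ler_mxl1D _ _)); rewrite mxl1Z.
have := Hd s Ts sd; set x := mxl1 _ => xle.
have : e / (2 * (sigma T t - t + 1)) * `|sigma T t - s| <= e / 2.
  rewrite mulrAC ler_pdivrMr; last by lra.
  have : `|sigma T t - s| <= sigma T t - t + 1.
    by move: s1; rewrite ltr_norml ler_norml; lra.
  by move=> /(ler_wpM2l (ltW e0)); lra.
have : `|s - t| * mxl1 D <= e / 2.
  move: s2; rewrite ltr_pdivlMr; last by have := mxl1_ge0 D; lra.
  by have := normr_ge0 (s - t); have := mxl1_ge0 D; lra.
by move: xle; lra.
Qed.

End DeltaDerivative.

(** * Solutions of linear systems *)

Lemma expR_sub1_small {R : realType} (K e : R) : 0 < e ->
  exists2 d : R, 0 < d & forall h, 0 <= h -> h < d -> expR (K * h) - 1 <= e.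
Proof.
move=> e0; have l0 : 0 < ln (1 + e) by apply: ln_gt0; lra.
have K0 : 0 < `|K| + 1 by rewrite ltr_wpDl.
exists (ln (1 + e) / (`|K| + 1)) => [|h h0 hd]; first exact: divr_gt0.
rewrite lerBlDl -[leRHS]lnK ?posrE; last by lra.
rewrite ler_expR; move: hd; rewrite ltr_pdivlMr // => hd.
have : K * h <= `|K| * h by rewrite ler_wpM2r // ler_norm.
by move: hd; lra.
Qed.

Section Flow.
Context {R : realType} (T : set R).
Hypotheses (Tcl : closed T) (Tub : unbounded_above T).
Context (n : nat) (A : R -> 'M[R]_n).
Hypothesis Abd : forall t, T t ->
  exists K : R, \forall s \near within T (nbhs t), mxl1 (A s) <= K.
Hypothesis Ard : forall t, right_dense T t -> forall e : R, 0 < e ->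
  \forall s \near within T (nbhs t), mxl1 (A s - A t) <= e.
Context (U : set_system (seq R)) {UU : UltraFilter U}.
Hypothesis TU : finite_partitions T `<=` U.

Local Notation Phi := (transition A U).

Lemma transition_near_id (t : R) : T t -> forall e : R, 0 < e ->
  exists2 d : R, 0 < d & forall a b, T a -> T b -> a <= b ->
    `|a - t| < d -> `|b - t| < d -> mxl1 (Phi b a - 1%:M) <= e.
Proof.
move=> Tt e e0; have [K /near_within_realP[d1 d10 AK]] := Abd Tt.
have [d2 d20 eK] := expR_sub1_small K e0.
(* Two points within [d2 / 2] of [t] are less than [d2] apart. *)
exists (Num.min d1 (d2 / 2)) => [|a b Ta Tb ab].
  by rewrite lt_min d10 divr_gt0.
rewrite !lt_min !ltr_norml => /andP[a1 a2] /andP[b1 b2].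
apply: (@le_trans _ _ (expR (K * (b - a)) - 1)); last by apply: eK; lra.
apply: (transition_bound Tcl Tub Abd TU) => // q Tq aqb.
by apply: AK; rewrite // ltr_norml; lra.
Qed.

(** At a right-dense point [A] is continuous from both sides, so the Taylor bound with [B = A t]
    holds for [a <= b] on either side of [t]. *)
Lemma transition_near_affine (t : R) : right_dense T t -> forall e : R, 0 < e ->
  exists2 d : R, 0 < d & forall a b, T a -> T b -> a <= b ->
    `|a - t| < d -> `|b - t| < d ->
    mxl1 (Phi b a - (1%:M + (b - a) *: A t)) <= e * (b - a).
Proof.
move=> rd e e0; have Tt := rd.1.
have [K /near_within_realP[d1 d10 AK]] := Abd Tt.
have e2 : 0 < e / 2 by lra.
have K0 : 0 < 2 * (`|K| + 1) by rewrite mulr_gt0 // ltr_wpDl.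
have [d2 d20 eK] := expR_sub1_small K (divr_gt0 e0 K0).
have /near_within_realP[d3 d30 AB] := Ard rd e2.
exists (Num.min d1 (Num.min d3 (d2 / 2))) => [|a b Ta Tb ab].
  by rewrite !lt_min d10 d30 divr_gt0.
rewrite !lt_min !ltr_norml => /and3P[a1 a3 a2] /and3P[b1 b3 b2].
apply: (@le_trans _ _ ((e / (2 * (`|K| + 1)) * K + e / 2) * (b - a))).
  apply: (transition_taylor Tcl Tub Abd TU) => //.
    by move=> q Tq aqb; split; [apply: AK|apply: AB]; rewrite // ltr_norml; lra.
  by apply: eK; lra.
rewrite ler_wpM2r ?subr_ge0 //.
suff : e / (2 * (`|K| + 1)) * K <= e / 2 by lra.
rewrite mulrAC ler_pdivrMr // mulrA divfK // ler_wpM2l ?ltW //.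
by have := ler_norm K; lra.
Qed.

Lemma transition_bounded (a b : R) : T a -> T b -> a <= b ->
  exists2 M, 0 <= M &
    forall s t, T s -> T t -> a <= s -> s <= t -> t <= b -> mxl1 (Phi t s) <= M.
Proof.
move=> Ta Tb ab; have [K AK] := bounded_on_segment Tcl Tub Abd Ta Tb ab.
have K0 : 0 <= K by apply: le_trans (mxl1_ge0 (A a)) (AK a Ta _); rewrite lexx.
exists (expR (K * (b - a)) - 1 + mxl1 (1%:M : 'M[R]_n)).
  rewrite addr_ge0 ?mxl1_ge0 // subr_ge0 (le_trans _ (expR_ge1Dx _)) // lerDl.
  by rewrite mulr_ge0 // subr_ge0.
move=> s t Ts Tt as_ st tb; rewrite -[Phi t s](subrK 1%:M).
apply: (le_trans (ler_mxl1D _ _)); rewrite lerD2r.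
apply: (@le_trans _ _ (expR (K * (t - s)) - 1)).
  by apply: (transition_bound Tcl Tub Abd TU) => // q Tq sqt; apply: AK => //; lra.
by rewrite lerB // ler_expR ler_wpM2l // lerB.
Qed.

(** Integrated form of [X^Delta = A X], equivalent to it by [flow_delta_solution] and
    [delta_solution_flow]. Like [Phi], it runs forward only. *)
Definition flow m (X : R -> 'M[R]_(n, m)) :=
  forall a b, T a -> T b -> a <= b -> X b = Phi b a *m X a.

Lemma flow_continuous m (X : R -> 'M[R]_(n, m)) : flow X ->
  forall t, T t -> forall e : R, 0 < e ->
  exists2 d : R, 0 < d & forall s, T s -> `|s - t| < d -> mxl1 (X s - X t) <= e.
Proof.
move=> Xf t Tt e e0; have N0 := mxl1_ge0 (X t).
(* For [s] left of [t] the bound is [e1 * mxl1 (X s)], with [X s] unknown. As [e1 <= 1 / 2], its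
   part [e1 * mxl1 (X s - X t)] is absorbed, leaving [2 * e1 * mxl1 (X t) <= e]. *)
pose e1 := Num.min (1 / 2) (e / (2 * (mxl1 (X t) + 1))).
have e10 : 0 < e1 by rewrite lt_min !divr_gt0 //; lra.
have e12 : e1 <= 1 / 2 by rewrite ge_min lexx.
have e1e : 2 * e1 * mxl1 (X t) <= e.
  have : e1 <= e / (2 * (mxl1 (X t) + 1)) by rewrite ge_min lexx orbT.
  by rewrite ler_pdivlMr; nra.
have [d d0 dP] := transition_near_id Tt e10; exists d => // s Ts sd.
have td : `|t - t| < d by rewrite subrr normr0.
have Ns : mxl1 (X s) <= mxl1 (X s - X t) + mxl1 (X t).
  by rewrite -{1}(subrK (X t) (X s)) ler_mxl1D.
have := mxl1_ge0 (X s - X t); have [st|ts] := leP s t.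
- have := dP s t Ts Tt st sd td; have := ler_mxl1M (Phi t s - 1%:M) (X s).
  rewrite mulmxBl mul1mx -Xf // mxl1_distC; set u := mxl1 (Phi t s - 1%:M).
  move=> h1 h2 h3; have := ler_wpM2r (mxl1_ge0 (X s)) h2.
  rewrite mxl1_distC in Ns.
  by have := ler_wpM2l (ltW e10) Ns; have := ler_wpM2r h3 e12; lra.
- have := dP t s Tt Ts (ltW ts) td sd; have := ler_mxl1M (Phi s t - 1%:M) (X t).
  rewrite mulmxBl mul1mx -Xf //; last exact: ltW.
  set u := mxl1 (Phi s t - 1%:M).
  by move=> h1 h2 h3; have := ler_wpM2r N0 h2; move: h1 e1e; lra.
Qed.

Lemma flow_delta_solution m (X : R -> 'M[R]_(n, m)) :
  flow X -> delta_solution T A X.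
Proof.
move=> Xf t Tt; apply/(mx_delta_deriveP Tub _ _ Tt).
have td d : 0 < d -> `|t - t| < d by rewrite subrr normr0.
have [rd|ts] := right_dense_or_scattered Tub Tt.
  rewrite /mu rd.2 subrr scale0r addr0; split=> // e e0.
  have N0 := mxl1_ge0 (X t); have A0 := mxl1_ge0 (A t).
  pose e1 := e / (2 * (mxl1 (X t) + 1)).
  have e10 : 0 < e1 by rewrite !divr_gt0 //; lra.
  have e1e : e1 * mxl1 (X t) <= e / 2.
    have : e1 * (2 * (mxl1 (X t) + 1)) = e.
      by rewrite divfK // lt0r_neq0 //; lra.
    by nra.
  pose e2 := Num.min 1 (e / (2 * (e1 + mxl1 (A t) + 1))).
  have e20 : 0 < e2 by rewrite lt_min ltr01 /= !divr_gt0 //; lra.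
  have e2e : e2 * (e1 + mxl1 (A t)) <= e / 2.
    have : e2 <= e / (2 * (e1 + mxl1 (A t) + 1)) by rewrite ge_min lexx orbT.
    by rewrite ler_pdivlMr; nra.
  have [d1 d10 dP] := transition_near_affine rd e10.
  have [d2 d20 dc] := flow_continuous Xf Tt e20.
  exists (Num.min d1 d2) => [|s Ts]; first by rewrite lt_min d10.
  rewrite lt_min => /andP[sd1 sd2]; have {}dc := dc s Ts sd2.
  (* For [s] left of [t] the affine approximation acts on [X s]; exchanging [X s] for [X t] in the
     linear term costs what continuity controls. *)
  have [st|ts] := leP s t.
  - rewrite ger0_norm ?subr_ge0 //; have := dP s t Ts Tt st sd1 (td _ d10).
    set E := Phi t s - _ => NE.
    have -> : X s - X t - (s - t) *: (A t *m X t) =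
        (t - s) *: (A t *m (X t - X s)) - E *m X s.
      rewrite /E mulmxBl mulmxDl mul1mx -Xf // -scalemxAl mulmxBr.
      move: (A t *m X t) (A t *m X s) => v w.
      by apply/matrixP => i j; rewrite !mxE; ring.
    apply: (le_trans (ler_mxl1D _ _)); rewrite mxl1N mxl1Z ger0_norm ?subr_ge0 //.
    have h0 : 0 <= t - s by rewrite subr_ge0.
    have := ler_mxl1M (A t) (X t - X s); rewrite mxl1_distC in dc.
    have := ler_mxl1M E (X s).
    have Ns : mxl1 (X s) <= e2 + mxl1 (X t).
      rewrite -(subrK (X t) (X s)) (le_trans (ler_mxl1D _ _)) //.
      by rewrite lerD2r mxl1_distC.
    have := ler_pM (mxl1_ge0 E) (mxl1_ge0 (X s)) NE Ns.
    have := ler_wpM2l A0 dc.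
    move: (mxl1 (_ *m (X t - X s))) (mxl1 (E *m X s)) => x y h1 h2 h3 h4.
    have : (t - s) * x <= (t - s) * (mxl1 (A t) * e2).
      by rewrite ler_wpM2l // (le_trans h4).
    have : (t - s) * (e1 * mxl1 (X t)) <= (t - s) * (e / 2) by rewrite ler_wpM2l.
    have : (t - s) * (e2 * (e1 + mxl1 (A t))) <= (t - s) * (e / 2).
      by rewrite ler_wpM2l.
    by move: h2 h3; lra.
  - rewrite distrC ger0_norm ?subr_ge0 ?ltW //.
    have := dP t s Tt Ts (ltW ts) (td _ d10) sd1.
    set E := Phi s t - _ => NE.
    have -> : X s - X t - (s - t) *: (A t *m X t) = E *m X t.
      rewrite /E mulmxBl mulmxDl mul1mx -Xf //; last exact: ltW.
      by rewrite -scalemxAl opprD addrA.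
    have := ler_mxl1M E (X t); have := ler_wpM2r N0 NE.
    have : (s - t) * (e1 * mxl1 (X t)) <= (s - t) * (e / 2).
      by rewrite ler_wpM2l // subr_ge0 ltW.
    have : 0 < (s - t) * e by rewrite mulr_gt0 // subr_gt0.
    by lra.
split.
  rewrite (Xf _ _ Tt (sigma_in Tcl Tub t) (ltW ts)).
  by rewrite (transition_sigma Tcl Tub Abd TU) // mulmxDl mul1mx -scalemxAl.
(* Near a right-scattered [t] the distance to [sigma T t] is at least [m0 / 2], so it suffices that
   [X s - X t] and [(s - t) *: D] are each at most [e * m0 / 4]. *)
move=> e e0; set D := A t *m X t; have D0 := mxl1_ge0 D.
pose m0 := sigma T t - t; have m00 : 0 < m0 by rewrite subr_gt0.
have e20 : 0 < e * m0 / 4 by rewrite divr_gt0 // mulr_gt0.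
have [d d0 dc] := flow_continuous Xf Tt e20.
have e30 : 0 < e * m0 / (4 * (mxl1 D + 1)).
  by rewrite divr_gt0 ?mulr_gt0 //; lra.
exists (Num.min d (Num.min (m0 / 2) (e * m0 / (4 * (mxl1 D + 1))))).
  by rewrite !lt_min d0 e30 divr_gt0.
move=> s Ts; rewrite !lt_min => /and3P[/(dc s Ts) sc sm sD].
apply: (le_trans (ler_mxl1D _ _)); rewrite mxl1N mxl1Z.
have : m0 / 2 <= `|sigma T t - s|.
  have sn := ler_norm (sigma T t - s).
  by move: sm; rewrite ltr_norml /m0 in sn *; lra.
move=> /(ler_wpM2l (ltW e0)).
move: sD; rewrite ltr_pdivlMr; last by lra.
by have := normr_ge0 (s - t); move: sc; lra.
Qed.

(** By the cocycle law [g q = Phi b q *m Z q] has increments [Phi b t *m (Z t - Phi t s *m Z s)].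
    The monotonicity criterion for [- mxl1 (g q - g a)] yields [g b = g a], which is the claim. *)
Lemma delta_solution_flow m (Z : R -> 'M[R]_(n, m)) :
  delta_solution T A Z -> flow Z.
Proof.
move=> ZA a b Ta Tb ab; pose g q := Phi b q *m Z q.
have [M M0 PhiM] := transition_bounded Ta Tb ab.
have step s t : T s -> T t -> a <= s -> s <= t -> t <= b ->
    mxl1 (g t - g s) <= M * mxl1 (Z t - Phi t s *m Z s).
  move=> Ts Tt as_ st tb.
  rewrite /g (transition_mul Tcl Tub Abd TU Ts Tt Tb st tb) -mulmxA -mulmxBr.
  apply: (le_trans (ler_mxl1M _ _)); rewrite ler_wpM2r ?mxl1_ge0 //.
  by apply: PhiM; rewrite ?(le_trans as_).
suff : - mxl1 (g a - g a) <= - mxl1 (g b - g a).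
  rewrite subrr mxl1_0 oppr0 oppr_ge0 => /mxl1_eq0/eqP; rewrite subr_eq0 => /eqP.
  by rewrite /g (transition_id Tcl Tub Abd TU Tb) mul1mx.
have mono s t : mxl1 (g t - g a) <= mxl1 (g s - g a) + mxl1 (g t - g s).
  rewrite (le_trans _ (ler_mxl1D _ _)) //.
  by rewrite [X in _ <= mxl1 X]addrC [X in _ <= mxl1 X]addrA subrK.
apply: (time_scale_nondecreasing Tcl Tub (h := fun q => - mxl1 (g q - g a))) => //.
- move=> t Tt /andP[at_ tb] ts; rewrite lerN2.
  have Ts : T (sigma T t) := sigma_in Tcl Tub t.
  have sb : sigma T t <= b by exact: sigma_le.
  have [Zs _] := (mx_delta_deriveP Tub _ _ Tt).1 (ZA t Tt).
  have := step t _ Tt Ts at_ (ltW ts) sb; have := mono t (sigma T t).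
  rewrite (transition_sigma Tcl Tub Abd TU Tt ts) Zs.
  by rewrite mulmxDl mul1mx -scalemxAl subrr mxl1_0 mulr0; lra.
- move=> t rd /andP[at_ tb] e e0; have Tt := rd.1.
  have N0 := mxl1_ge0 (Z t).
  pose c := M * (1 + mxl1 (Z t)) + 1.
  have c0 : 0 < c by rewrite ltr_wpDl // mulr_ge0 // addr_ge0.
  have ec0 : 0 < e / c by rewrite divr_gt0.
  have ecc : e / c * c = e by rewrite divfK // lt0r_neq0.
  have [_ /(_ _ ec0)[d1 d10 HZ]] := (mx_delta_deriveP Tub _ _ Tt).1 (ZA t Tt).
  have [d2 d20 HP] := transition_near_affine rd ec0.
  exists (Num.min d1 d2) => [|s Ts /andP[ts]]; first by rewrite lt_min d10.
  rewrite -ltrBlDl lt_min => /andP[sd1 sd2] sb.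
  have st0 : 0 <= s - t by lra.
  have := mono t s; have := step t s Tt Ts at_ (ltW ts) sb.
  have : mxl1 (Z s - Phi s t *m Z t) <= e / c * (s - t) * (1 + mxl1 (Z t)).
    have := HP t s Tt Ts (ltW ts); rewrite subrr normr0 d20 ger0_norm // sd2.
    move=> /(_ isT isT); set E := Phi s t - _ => NE.
    have := HZ s Ts; rewrite ger0_norm // sd1 rd.2 distrC ger0_norm // => /(_ isT).
    set v := Z s - _ - _ => Nv.
    (* [Z] and [Phi] have the same linear part at [t], so only the two remainders are left. *)
    have -> : Z s - Phi s t *m Z t = v - E *m Z t.
      rewrite /E mulmxBl mulmxDl mul1mx -scalemxAl /v.
      move: (Phi s t *m Z t) (A t *m Z t) => x y.
      by apply/matrixP => i j; rewrite !mxE; ring.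
    apply: (le_trans (ler_mxl1D _ _)); rewrite mxl1N mulrDr mulr1 lerD //.
    by rewrite (le_trans (ler_mxl1M _ _)) // ler_wpM2r.
  move=> h1 h2 h3; have h4 := ler_wpM2l M0 h1.
  have : e * (s - t) = e / c * c * (s - t) by rewrite ecc.
  have : 0 <= e / c * (s - t) by rewrite mulr_ge0 // ltW.
  by rewrite /c in h4 *; lra.
- move=> t ld /andP[at_ tb] e e0; case: (ld) => Tt _ _.
  have N0 := mxl1_ge0 (Z t).
  pose c := M * (2 + mxl1 (Z t)) + 1.
  have c0 : 0 < c by rewrite ltr_wpDl // mulr_ge0 // addr_ge0.
  pose x := Num.min 1 (e / c).
  have x0 : 0 < x by rewrite lt_min ltr01 divr_gt0.
  have x1 : x <= 1 by rewrite ge_min lexx.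
  have xc : x * c <= e.
    by rewrite -ler_pdivlMr // ge_min lexx orbT.
  have [d1 d10 HZ] := mx_delta_derive_continuous Tub Tt (ZA t Tt) x0.
  have [d2 d20 HP] := transition_near_id Tt x0.
  exists (Num.min d1 d2) => [|s Ts /andP[ts st] as_]; first by rewrite lt_min d10.
  move: ts; rewrite ltrBlDr -ltrBlDl lt_min => /andP[sd1 sd2].
  have st0 : 0 <= t - s by lra.
  have := mono s t; have := step s t Ts Tt as_ (ltW st) tb.
  have : mxl1 (Z t - Phi t s *m Z s) <= x * (2 + mxl1 (Z t)).
    have := HP s t Ts Tt (ltW st); rewrite subrr normr0 d20 distrC ger0_norm // sd2.
    move=> /(_ isT isT); set E := Phi t s - _ => NE.
    have := HZ s Ts; rewrite distrC ger0_norm // sd1 => /(_ isT) Nv.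
    have -> : Z t - Phi t s *m Z s = - (Z s - Z t) - E *m Z s.
      rewrite /E mulmxBl mul1mx; move: (Phi t s *m Z s) => y.
      by apply/matrixP => i j; rewrite !mxE; ring.
    apply: (le_trans (ler_mxl1D _ _)); rewrite !mxl1N.
    have Ns : mxl1 (Z s) <= 1 + mxl1 (Z t).
      rewrite -(subrK (Z t) (Z s)) (le_trans (ler_mxl1D _ _)) // lerD2r.
      exact: le_trans Nv x1.
    have := ler_pM (mxl1_ge0 E) (mxl1_ge0 (Z s)) NE Ns.
    by have := ler_mxl1M E (Z s); lra.
  move=> h1 h2 h3; have h4 := ler_wpM2l M0 h1.
  by rewrite /c in xc; lra.
Qed.

(** * Invertibility of the transition matrix and solutions backwards in time *)

Hypothesis Areg : regressive T A.

(** Near any point [Phi b a] is within [1 / 2] of the identity, hence invertible; across a gap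
    regressivity applies. Induction glues the pieces by the cocycle law. *)
Lemma transition_unit (s t : R) : T s -> T t -> s <= t -> Phi t s \in unitmx.
Proof.
move=> Ts; have near_unit r : T r -> exists2 d : R, 0 < d & forall a b,
    T a -> T b -> a <= b -> `|a - r| < d -> `|b - r| < d -> Phi b a \in unitmx.
  move=> Tr; have h0 : 0 < 1 / 2 :> R by lra.
  have [d d0 Hd] := transition_near_id Tr h0.
  exists d => // a b Ta Tb ab ad bd; apply: mxl1_lt1_unit.
  by have := Hd a b Ta Tb ab ad bd; lra.
move: t; apply: (time_scale_ind Tcl Tub Ts).
- by rewrite (transition_id Tcl Tub Abd TU Ts) unitmx1.
- move=> t Tt st tS IH; have TS : T (sigma T t) := sigma_in Tcl Tub t.
  rewrite (transition_mul Tcl Tub Abd TU Ts Tt TS st (ltW tS)) unitmx_mul IH andbT.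
  by rewrite (transition_sigma Tcl Tub Abd TU Tt tS) Areg.
- move=> t [Tt _] st IH; have [d d0 Hd] := near_unit t Tt.
  exists d => // u Tu /andP[tu ud].
  rewrite (transition_mul Tcl Tub Abd TU Ts Tt Tu st (ltW tu)) unitmx_mul IH andbT.
  by apply: Hd; rewrite ?subrr ?normr0 ?(ltW tu) // gtr0_norm; lra.
- move=> t ld st IH; case: (ld) => Tt _ _; have [d d0 Hd] := near_unit t Tt.
  have m0 : 0 < Num.min d (t - s) by rewrite lt_min d0 subr_gt0.
  have [q Tq] := left_dense_approx ld m0.
  rewrite ltrBlDr -ltrBlDl lt_min => /andP[/andP[tqd tqs] qt].
  have sq : s <= q by lra.
  rewrite (transition_mul Tcl Tub Abd TU Ts Tq Tt sq (ltW qt)) unitmx_mul.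
  apply/andP; split; last by apply: IH => //; rewrite sq.
  by apply: Hd; rewrite ?subrr ?normr0 ?(ltW qt) // distrC gtr0_norm; lra.
Qed.

(* [Phi t s] is only meaningful for [s <= t]; times before [t0] are reached by
   inverting [Phi]. *)
Definition fundamental (t0 t : R) : 'M[R]_n :=
  Phi t (Num.min t t0) *m invmx (Phi t0 (Num.min t t0)).

Lemma fundamental_id (t0 : R) : T t0 -> fundamental t0 t0 = 1%:M.
Proof. by move=> Tt; rewrite /fundamental minxx mulmxV // transition_unit. Qed.

Lemma fundamental_flow (t0 : R) : T t0 -> flow (fundamental t0).
Proof.
(* Any common earlier time [q] may replace the minimum of [t] and [t0]: the additional factor
   cancels by the cocycle law. *)
move=> T0; have eqF q t : T q -> T t -> q <= t -> q <= t0 ->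
    fundamental t0 t = Phi t q *m invmx (Phi t0 q).
  move=> Tq Tt qt q0; rewrite /fundamental; have [t0t|tt0] := ltP t t0.
    rewrite (transition_id Tcl Tub Abd TU Tt) mul1mx.
    have u1 := transition_unit Tq Tt qt.
    have u2 := transition_unit Tt T0 (ltW t0t).
    rewrite (transition_mul Tcl Tub Abd TU Tq Tt T0 qt (ltW t0t)).
    apply: (can_inj (mulKmx u2)); rewrite mulmxV // mulmxA.
    by rewrite mulmxV // unitmx_mul u2.
  rewrite (transition_id Tcl Tub Abd TU T0) invmx1 mulmx1.
  rewrite (transition_mul Tcl Tub Abd TU Tq T0 Tt q0 tt0) -mulmxA.
  by rewrite mulmxV ?mulmx1 // transition_unit.
move=> a b Ta Tb ab; have Tq : T (Num.min a t0) by rewrite minElt; case: ifP.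
have qa : Num.min a t0 <= a by rewrite ge_min lexx.
have q0 : Num.min a t0 <= t0 by rewrite ge_min lexx orbT.
rewrite (eqF _ _ Tq Tb (le_trans qa ab) q0) (eqF _ _ Tq Ta qa q0) mulmxA.
by rewrite -(transition_mul Tcl Tub Abd TU Tq Ta Tb qa ab).
Qed.

(** For [t < t0] both sides are carried forward to [t0], where they agree, and the invertible
    [Phi t0 t] is cancelled. *)
Lemma flow_fundamental (t0 : R) m (Z : R -> 'M[R]_(n, m)) : T t0 -> flow Z ->
  forall t, T t -> Z t = fundamental t0 t *m Z t0.
Proof.
move=> T0 Zf t Tt; have Xf := fundamental_flow T0.
have [t0t|tt0] := leP t0 t.
  by rewrite (Zf t0 t) // (Xf t0 t) // fundamental_id // mulmx1.
have u := transition_unit Tt T0 (ltW tt0).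
apply: (can_inj (mulKmx u)); rewrite mulmxA -Xf ?(ltW tt0) //.
by rewrite fundamental_id // mul1mx -Zf // ltW.
Qed.

End Flow.

(** * Rd-continuous functions *)

Section RdContinuity.
Context {R : realType} (T : set R).
Hypotheses (Tcl : closed T) (Tub : unbounded_above T).

Lemma near_within_leftP (t : R) (P : R -> Prop) :
  (\forall s \near within T (t^'-), P s) <->
  exists2 d : R, 0 < d & forall s, T s -> t - d < s < t -> P s.
Proof.
rewrite near_withinE /at_left; split.
  move=> /near_within_realP[d d0 dP]; exists d => // s Ts /andP[tds st].
  by apply: dP => //; rewrite ltr_norml; lra.
move=> [d d0 dP]; apply/near_within_realP; exists d => // s st.
by rewrite ltr_norml => tds Ts; apply: dP => //; move: st => /=; lra.
Qed.

Lemma within_left_sub (t : R) : within T (t^'-) `=>` within T (nbhs t).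
Proof.
move=> Q /near_within_realP[d d0 dQ]; apply/near_within_leftP; exists d => // s Ts.
by move=> tds; apply: dQ => //; rewrite ltr_norml; lra.
Qed.

Lemma cvg_rd_continuous (f : R -> R) :
  (forall t, T t -> f s @[s --> within T (nbhs t)] --> f t) ->
  rd_continuous T f.
Proof.
move=> fT; split=> t [Tt ? *]; first exact: fT.
by exists (f t) => Q /(fT t Tt); exact: within_left_sub.
Qed.

Lemma rd_continuous_cst (c : R) : rd_continuous T (fun=> c).
Proof. by apply: cvg_rd_continuous => t _; exact: cvg_cst. Qed.

Lemma rd_continuousM (f g : R -> R) :
  rd_continuous T f -> rd_continuous T g -> rd_continuous T (fun t => f t * g t).
Proof.
move=> [fr fl] [gr gl]; split=> t tT; first by apply: cvgM; [exact: fr|exact: gr].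
have [l fl'] := fl t tT; have [k gk] := gl t tT.
by exists (l * k); exact: cvgM.
Qed.

Lemma rd_continuousD (f g : R -> R) :
  rd_continuous T f -> rd_continuous T g -> rd_continuous T (fun t => f t + g t).
Proof.
move=> [fr fl] [gr gl]; split=> t tT; first by apply: cvgD; [exact: fr|exact: gr].
have [l fl'] := fl t tT; have [k gk] := gl t tT.
by exists (l + k); exact: cvgD.
Qed.

Lemma rd_continuous_sum (J : Type) (r : seq J) (f : J -> R -> R) :
  (forall j, rd_continuous T (f j)) ->
  rd_continuous T (fun t => \sum_(j <- r) f j t).
Proof.
move=> frd; elim: r => [|j r IH].
  by under eq_fun do rewrite big_nil; exact: rd_continuous_cst.
by under eq_fun do rewrite big_cons; exact: rd_continuousD.
Qed.

Lemma mx_rd_continuousM m n k (X : R -> 'M[R]_(m, n)) (Y : R -> 'M[R]_(n, k)) :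
  mx_rd_continuous T X -> mx_rd_continuous T Y ->
  mx_rd_continuous T (fun t => X t *m Y t).
Proof.
move=> Xr Yr i j; under eq_fun do rewrite mxE.
by apply: rd_continuous_sum => l; exact: rd_continuousM.
Qed.

Lemma mx_rd_continuous_tr m n (X : R -> 'M[R]_(m, n)) :
  mx_rd_continuous T X -> mx_rd_continuous T (fun t => (X t)^T).
Proof. by move=> Xr i j; under eq_fun do rewrite mxE; exact: Xr. Qed.

Lemma delta_solution_rd_continuous m n (A : R -> 'M[R]_n)
    (X : R -> 'M[R]_(n, m)) :
  delta_solution T A X -> mx_rd_continuous T X.
Proof.
move=> XA i j; apply: cvg_rd_continuous => t Tt; apply/cvgrPdist_le => e e0.
have [d d0 dX] := mx_delta_derive_continuous Tub Tt (XA t Tt) e0.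
apply/near_within_realP; exists d => // s Ts /(dX s Ts); apply: le_trans.
by rewrite distrC; have := ler_entry_mxl1 (X s - X t) i j; rewrite !mxE.
Qed.

Lemma rd_continuous_bounded (f : R -> R) (t : R) : rd_continuous T f -> T t ->
  exists K : R, \forall s \near within T (nbhs t), `|f s| <= K.
Proof.
move=> [fr fl] Tt.
have [rd|ts] := right_dense_or_scattered Tub Tt.
  exists (`|f t| + 1).
  have := fr t rd; move=> /cvgrPdist_le/(_ 1 ltr01); apply: filterS => s fs.
  rewrite -(subrK (f t) (f s)) addrC (le_trans (ler_normD _ _)) // lerD2l.
  by rewrite distrC.
(* A right-scattered [t] is isolated from the right, so a bound on its left suffices. There [T] has
   no point at all, a left limit, or a gap of length [t - q]. *)
suff [d d0 [K HK]] : exists2 d : R, 0 < d &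
    exists K : R, forall s, T s -> t - d < s < t -> `|f s| <= K.
  exists (Num.max K `|f t|); apply/near_within_realP.
  exists (Num.min d (sigma T t - t)) => [|s Ts]; first by rewrite lt_min d0 subr_gt0.
  rewrite lt_min !ltr_norml => /andP[sd ss]; rewrite le_max.
  have [st|ts'|->] := ltgtP s t; last by rewrite lexx orbT.
    by rewrite HK //; lra.
  by have := sigma_le Tub Ts ts'; lra.
have [[a Ta at_]|noa] := pselect (exists2 a, T a & a < t); last first.
  exists 1 => //; exists 0 => s Ts /andP[_ st]; exfalso; apply: noa.
  by exists s.
have [ld|[q [Tq /andP[aq qt] sq]]] := left_dense_or_scattered Tcl Tub Ta Tt at_.
  have [l /cvgrPdist_le/(_ 1 ltr01)/near_within_leftP[d d0 dl]] := fl t ld.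
  exists d => //; exists (`|l| + 1) => s Ts /(dl s Ts) fs.
  rewrite -(subrK l (f s)) addrC (le_trans (ler_normD _ _)) // lerD2l.
  by rewrite distrC.
exists (t - q); first by rewrite subr_gt0.
exists 0 => s Ts /andP[qs st]; have := sigma_le Tub Ts (_ : q < s).
by rewrite sq; lra.
Qed.

Lemma mx_rd_continuous_bounded m n (A : R -> 'M[R]_(m, n)) (t : R) :
  mx_rd_continuous T A -> T t ->
  exists K : R, \forall s \near within T (nbhs t), mxl1 (A s) <= K.
Proof.
move=> Ar Tt.
have /choice[K HK] : forall ij : 'I_m * 'I_n, exists K : R,
    \forall s \near within T (nbhs t), `|A s ij.1 ij.2| <= K.
  by move=> ij; exact: rd_continuous_bounded.
exists (\sum_i \sum_j K (i, j)); apply: filterS (filter_forall _ HK) => s sK.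
by apply: ler_sum => i _; apply: ler_sum => j _; exact: (sK (i, j)).
Qed.

Lemma mx_rd_continuous_right_dense m n (A : R -> 'M[R]_(m, n)) (t : R) :
  mx_rd_continuous T A -> right_dense T t -> forall e : R, 0 < e ->
  \forall s \near within T (nbhs t), mxl1 (A s - A t) <= e.
Proof.
move=> Ar rd e e0; have tT := rd.1.
have : mxl1 (A s - A t) @[s --> within T (nbhs t)] --> mxl1 (A t - A t).
  apply: cvg_finsum => i; apply: cvg_finsum => j; apply: cvg_norm.
  rewrite mxE; under eq_fun do rewrite mxE; apply: cvgD; first exact: (Ar i j).1.
  exact: cvg_cst.
rewrite subrr mxl1_0 => /cvgrPdist_le/(_ e e0); apply: filterS => s.
by rewrite sub0r normrN; apply: le_trans; exact: ler_norm.
Qed.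

(** The last clause gives uniqueness on [T], so the result does not depend on the ultrafilter chosen
    in the proof. *)
Theorem fundamental_solution_exists n (A : R -> 'M[R]_n) (t0 : R) :
  mx_rd_continuous T A -> regressive T A -> T t0 ->
  exists X : R -> 'M[R]_n, [/\ delta_solution T A X, X t0 = 1%:M &
    forall m (Z : R -> 'M[R]_(n, m)), delta_solution T A Z ->
      forall t, T t -> Z t = X t *m Z t0].
Proof.
move=> Ar Areg T0.
have Abd t : T t ->
    exists K : R, \forall s \near within T (nbhs t), mxl1 (A s) <= K.
  exact: mx_rd_continuous_bounded.
have Ard t : right_dense T t -> forall e : R, 0 < e ->
    \forall s \near within T (nbhs t), mxl1 (A s - A t) <= e.
  exact: mx_rd_continuous_right_dense.
have [U [UU TU]] := ultraFilterLemma (finite_partitions_filter T).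
exists (fundamental A U t0); split.
- apply: (flow_delta_solution Tcl Tub Abd Ard TU).
  exact: (fundamental_flow Tcl Tub Abd TU Areg).
- exact: (fundamental_id Tcl Tub Abd TU Areg).
- move=> m Z ZA t Tt; apply: (flow_fundamental Tcl Tub Abd TU Areg T0) => //.
  exact: (delta_solution_flow Tcl Tub Abd Ard TU).
Qed.

End RdContinuity.

(** * Antiderivatives and observability *)

Section DeltaIntegral.
Context {R : realType} (T : set R).
Hypotheses (Tcl : closed T) (Tub : unbounded_above T).

Lemma is_delta_deriveN (f : R -> R) (t d : R) :
  is_delta_derive T f t d -> is_delta_derive T (fun s => - f s) t (- d).
Proof.
move=> fd e e0; apply: filterS (fd e e0) => s; rewrite -normrN.
by congr (`|_| <= _); ring.
Qed.

Lemma is_delta_deriveB (f g : R -> R) (t c d : R) :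
  is_delta_derive T f t c -> is_delta_derive T g t d ->
  is_delta_derive T (fun s => f s - g s) t (c - d).
Proof.
move=> fc gd e e0; have e20 : 0 < e / 2 by lra.
apply: filterS2 (fc _ e20) (gd _ e20) => s fs gs.
set u := _ * (_ - s) in fs; set v := _ * (_ - s) in gs.
have -> : f (sigma T t) - g (sigma T t) - (f s - g s) - (c - d) * (sigma T t - s) =
    (f (sigma T t) - f s - u) - (g (sigma T t) - g s - v) by rewrite /u /v; ring.
by apply: (le_trans (ler_normB _ _)); lra.
Qed.

Lemma delta_antiderivative_le (f F : R -> R) (a b : R) :
  T a -> T b -> a <= b -> delta_antiderivative T f F ->
  (forall t, T t -> a <= t < b -> 0 <= f t) -> F a <= F b.
Proof.
move=> Ta Tb ab Ff f0; apply: (time_scale_nondecreasing Tcl Tub) => //.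
- move=> t Tt tab ts; rewrite (is_delta_derive_sigma Tub Tt (Ff t Tt)) lerDl.
  by rewrite mulr_ge0 ?f0 // /mu subr_ge0 ltW.
- move=> t [Tt st] tab e e0; have /near_within_realP[d d0 dP] := Ff t Tt e e0.
  exists d => // s Ts /andP[ts sd] _; have := dP s Ts.
  rewrite st (distrC t s) !(ger0_norm (_ : 0 <= s - t)); last by lra.
  have : 0 <= f t * (s - t) by rewrite mulr_ge0 ?f0 //; lra.
  have -> : s - t < d by lra.
  by move=> + /(_ isT); rewrite ler_norml => + /andP[]; lra.
- move=> t [Tt _ _] tab e e0.
  (* A scalar is viewed as a matrix of size one to reuse the continuity of differentiable
     functions. *)
  have FD : is_mx_delta_derive T (fun s => (F s)%:M : 'M[R]_1) t (f t)%:M.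
    move=> i j; rewrite !ord1 mxE eqxx mulr1n.
    by under eq_fun do rewrite mxE eqxx mulr1n; exact: Ff.
  have [d d0 dP] := mx_delta_derive_continuous Tub Tt FD e0.
  exists d => // s Ts /andP[ts sd] _.
  have := dP s Ts; rewrite ltr_norml => /(_ (ltac:(lra))).
  move=> /(le_trans (ler_entry_mxl1 _ 0 0)); rewrite !mxE eqxx !mulr1n.
  by rewrite ler_norml; lra.
Qed.

Lemma delta_antiderivative_eq (f F : R -> R) (a b : R) :
  T a -> T b -> a <= b -> delta_antiderivative T f F ->
  (forall t, T t -> a <= t < b -> f t = 0) -> F a = F b.
Proof.
move=> Ta Tb ab Ff f0; apply/eqP; rewrite eq_le.
rewrite (delta_antiderivative_le Ta Tb ab Ff) => [|t Tt tab]; last by rewrite f0.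
rewrite -lerN2.
apply: (@delta_antiderivative_le (fun t => - f t) (fun t => - F t)) => //.
  by move=> t Tt; apply: is_delta_deriveN; exact: Ff.
by move=> t Tt tab; rewrite f0 // oppr0.
Qed.

(** Monotonicity squeezes [F] between equal end values, so it is constant on [[a, b]]. Then
    [f t = 0] by the jump formula at a right-scattered point, and by comparison with points of []t,
    b[] at a right-dense one. *)
Lemma delta_antiderivative_eq0 (f F : R -> R) (a b : R) :
  T a -> T b -> delta_antiderivative T f F ->
  (forall t, T t -> a <= t < b -> 0 <= f t) -> F a = F b ->
  forall t, T t -> a <= t < b -> f t = 0.
Proof.
move=> Ta Tb Ff f0 Fab t Tt /andP[at_ tb]; have ft0 := f0 t Tt (ltac:(lra)).
have Fcst s : T s -> a <= s <= b -> F s = F b.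
  move=> Ts /andP[as_ sb]; apply/eqP; rewrite eq_le -[in X in _ && X]Fab.
  rewrite (delta_antiderivative_le Ts Tb sb Ff).
    rewrite (delta_antiderivative_le Ta Ts as_ Ff) //.
    by move=> r Tr rs; apply: f0 => //; lra.
  by move=> r Tr rs; apply: f0 => //; lra.
have [rd|ts] := right_dense_or_scattered Tub Tt; last first.
  have := is_delta_derive_sigma Tub Tt (Ff t Tt).
  have sb := sigma_le Tub Tb tb.
  rewrite !Fcst ?at_ ?(ltW tb) //; first last.
  - by rewrite sb (le_trans at_) // ltW.
  - exact: sigma_in.
  move/eqP; rewrite -subr_eq0 opprD addrA subrr sub0r oppr_eq0 mulf_eq0 /mu subr_eq0.
  by rewrite gt_eqF //= => /eqP.
apply/eqP; rewrite eq_le ft0 andbT; apply/ler_addgt0Pr => e e0; rewrite add0r.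
have /near_within_realP[d d0 dP] := Ff t Tt e e0.
have m0 : 0 < Num.min d (b - t) by rewrite lt_min d0 subr_gt0.
have [s Ts] := right_dense_approx Tub rd m0.
rewrite -ltrBlDl lt_min => /and3P[ts sd sb].
have := dP s Ts; rewrite gtr0_norm ?subr_gt0 // rd.2 => /(_ sd).
rewrite !Fcst // ?at_ ?(ltW tb) //; last by lra.
rewrite subrr sub0r normrN normrM ger0_norm // ler_pM2r //.
by rewrite normr_gt0; lra.
Qed.

(** The difference of two antiderivatives has zero derivative, so their increments agree and the
    selected value is unique. *)
Lemma delta_integral_eq (f F : R -> R) (a b : R) : T a -> T b -> a <= b ->
  delta_antiderivative T f F -> delta_integral T f a b = F b - F a.
Proof.
move=> Ta Tb ab Ff; apply: xget_unique; first by exists F.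
move=> _ [G Gf ->].
have : F a - G a = F b - G b.
  apply: (@delta_antiderivative_eq (fun t => f t - f t) (fun t => F t - G t)) => //.
    by move=> t Tt; apply: is_delta_deriveB; [exact: Ff|exact: Gf].
  by move=> t _ _; rewrite subrr.
by lra.
Qed.

(* The antiderivative is the off-diagonal entry of a fundamental solution of
   [[F; 1]^Delta = [[0, f]; [0, 0]] [F; 1]]; this system is regressive because
   its matrix is nilpotent. *)
Lemma rd_continuous_antiderivative (f : R -> R) : T !=set0 ->
  rd_continuous T f -> exists F, delta_antiderivative T f F.
Proof.
move=> [t0 T0] fr; pose N : 'M[R]_2 := delta_mx 0 1.
have NN : N *m N = 0 by rewrite mul_delta_mx_0.
have Ar : mx_rd_continuous T (fun t => f t *: N).
  move=> i j; under eq_fun do rewrite mxE.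
  exact: rd_continuousM (rd_continuous_cst _ _).
have Areg : regressive T (fun t => f t *: N).
  move=> t Tt; rewrite scalerA; set c := _ * _.
  suff /mulmx1_unit[] : (1%:M + c *: N) *m (1%:M - c *: N) = 1%:M by [].
  rewrite mulmxBr mulmx1 mulmxDl mul1mx -scalemxAl -scalemxAr NN !scaler0 addr0.
  by rewrite addrK.
have [X [XA X0 _]] := fundamental_solution_exists Tcl Tub Ar Areg T0.
have NX t : (f t *: N) *m X t = f t *: (N *m X t) by rewrite scalemxAl.
(* The bottom row of [N] vanishes, so this entry keeps its initial value 1, and the entry [0 1] has
   derivative [f t * 1]. *)
have X1 t : T t -> X t 1 1 = 1.
  have D1 : delta_antiderivative T (fun=> 0) (fun s => X s 1 1).
    move=> s Ts; have := XA s Ts 1 1; rewrite NX !mxE big_ord_recl big_ord1 !mxE.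
    by rewrite !mul0r addr0 mulr0.
  move=> Tt; rewrite -[RHS](_ : X t0 1 1 = 1); last by rewrite X0 mxE eqxx.
  have [tt|tt] := leP t t0.
    exact: (delta_antiderivative_eq Tt T0 tt D1).
  by apply/esym/(delta_antiderivative_eq T0 Tt (ltW tt) D1).
exists (fun s => X s 0 1) => t Tt; have := XA t Tt 0 1.
rewrite NX !mxE big_ord_recl big_ord1 !mxE /= mul0r add0r mul1r.
by rewrite (_ : lift 0 0 = 1) ?X1 ?mulr1 //; apply/val_inj.
Qed.

(** Used for superposition of solutions, and to turn [F] into scalar antiderivatives such as that of
    the quadratic form of [M]. *)
Lemma is_mx_delta_derive_mul m n k l (P : 'M[R]_(m, n)) (Q : 'M[R]_(k, l))
    (X : R -> 'M[R]_(n, k)) (t : R) D : T t ->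
  is_mx_delta_derive T X t D ->
  is_mx_delta_derive T (fun s => P *m X s *m Q) t (P *m D *m Q).
Proof.
move=> Tt /(mx_delta_deriveP Tub _ _ Tt)[Xs XD].
apply/(mx_delta_deriveP Tub _ _ Tt); split.
  by rewrite Xs mulmxDr mulmxDl -scalemxAr -scalemxAl.
move=> e e0; have PQ0 := mulr_ge0 (mxl1_ge0 P) (mxl1_ge0 Q).
have c0 : 0 < mxl1 P * mxl1 Q + 1 by lra.
have [d d0 dX] := XD _ (divr_gt0 e0 c0); exists d => // s Ts /(dX s Ts) Xsd.
rewrite scalemxAl scalemxAr -!mulmxBl -!mulmxBr.
apply: (le_trans (ler_mxl1M _ _)).
have := ler_wpM2r (mxl1_ge0 Q) (ler_mxl1M P (X s - X t - (s - t) *: D)).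
move=> /le_trans; apply; rewrite mulrAC.
apply: (le_trans (ler_wpM2l PQ0 Xsd)); rewrite mulrA ler_wpM2r //.
by rewrite mulrA ler_pdivrMr // mulrC ler_wpM2l ?ltW //; lra.
Qed.

Lemma delta_solutionM m n k (A : R -> 'M[R]_n) (X : R -> 'M[R]_(n, m))
    (Q : 'M[R]_(m, k)) :
  delta_solution T A X -> delta_solution T A (fun t => X t *m Q).
Proof.
move=> XA t Tt; have := is_mx_delta_derive_mul 1%:M Q Tt (XA t Tt).
rewrite mul1mx mulmxA.
by under [X in is_mx_delta_derive _ X]eq_fun do rewrite mul1mx.
Qed.

Lemma mx_rd_continuous_antiderivative m n (M : R -> 'M[R]_(m, n)) : T !=set0 ->
  mx_rd_continuous T M ->
  exists F : R -> 'M[R]_(m, n), forall t, T t -> is_mx_delta_derive T F t (M t).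
Proof.
move=> T0 Mr; have /choice[F HF] : forall ij : 'I_m * 'I_n,
    exists F, delta_antiderivative T (fun t => M t ij.1 ij.2) F.
  by move=> ij; apply: rd_continuous_antiderivative.
exists (fun t => \matrix_(i, j) F (i, j) t) => t Tt i j.
by under eq_fun do rewrite mxE; exact: (HF (i, j)).
Qed.

End DeltaIntegral.

(** * The Gramian criterion for observability *)

Lemma transition_matrixE (R : realType) (T : set R) (n : nat) (A X : R -> 'M[R]_n)
    (t0 : R) : delta_solution T A X -> X t0 = 1%:M ->
  (forall Z : R -> 'M[R]_n, delta_solution T A Z ->
    forall t, T t -> Z t = X t *m Z t0) ->
  forall t, T t -> transition_matrix T A t t0 = X t.
Proof.
move=> XA X0 XZ t Tt; apply: xget_unique; first by exists X.
by move=> _ [Z [ZA Z0 ->]]; rewrite (XZ Z ZA t Tt) Z0 mulmx1.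
Qed.

Theorem theorem3p2 (R : realType) (T : set R)
    (hT : time_scale T) (hub : unbounded_above T) (hmu : bounded_graininess T)
    (t0 tf : R) (ht0 : T t0) (htf : T tf) (h0f : t0 < tf)
    (n p : nat) (A : R -> 'M[R]_n) (C : R -> 'M[R]_(p, n))
    (hA : mx_rd_continuous T A) (hC : mx_rd_continuous T C)
    (hreg : regressive T A) :
  observable T A C t0 tf <->
  observability_gramian T A C t0 tf \in unitmx.
Proof.
have [T0 Tcl] := hT.
have [X [XA X0 XZ]] := fundamental_solution_exists Tcl hub hA hreg ht0.
have PhiX := transition_matrixE XA X0 (fun Z => XZ n Z).
pose M t := (X t)^T *m (C t)^T *m C t *m X t.
have Xr : mx_rd_continuous T X := delta_solution_rd_continuous hub XA.
have Mr : mx_rd_continuous T M.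
  by do !apply: mx_rd_continuousM => //; apply: mx_rd_continuous_tr.
have [F FM] := mx_rd_continuous_antiderivative Tcl hub T0 Mr.
have -> : observability_gramian T A C t0 tf = F tf - F t0.
  apply/matrixP => i j; rewrite mxE.
  rewrite (delta_integral_eq Tcl hub (F := fun t => F t i j)) ?(ltW h0f) // ?mxE //.
  by move=> t Tt; rewrite PhiX //; exact: FM.
have FPQ k l (P : 'M[R]_(k, n)) (Q : 'M[R]_(n, l)) i j :
    delta_antiderivative T (fun t => (P *m M t *m Q) i j)
      (fun t => (P *m F t *m Q) i j).
  by move=> t Tt; exact: (is_mx_delta_derive_mul hub P Q Tt (FM t Tt)).
have sys x0 : linear_system T A C t0 x0 (fun t => X t *m x0)
    (fun t => C t *m (X t *m x0)).
  by split=> //; [exact: delta_solutionM|rewrite X0 mul1mx].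
split=> [obs|Gu x0 x0' x x' y y' [xA xt0 yx] [xA' xt0' yx'] yy'].
  (* It suffices to kill each row [v] of the kernel of the transposed Gramian; then [v^T] is a
     column killed by the Gramian itself. *)
  rewrite -unitmx_tr -row_free_unit -kermx_eq0; apply/eqP/row_matrixP => k.
  rewrite row0; set v := row k _.
  have vG : v *m (F tf - F t0)^T = 0 by rewrite /v -row_mul mulmx_ker row0.
  have Gv : (F tf - F t0) *m v^T = 0.
    by rewrite -[LHS]trmxK trmx_mul trmxK vG trmx0.
  (* The quadratic form of the integrand is a sum of squares, hence nonnegative. *)
  have Mnorm t : v *m M t *m v^T = (C t *m X t *m v^T)^T *m (C t *m X t *m v^T).
    by rewrite /M !trmx_mul trmxK !mulmxA.
  have CX0 t : T t -> t0 <= t < tf -> C t *m (X t *m v^T) = 0.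
    move=> Tt tt; rewrite mulmxA; set w := C t *m X t *m v^T.
    have : (v *m M t *m v^T) 0 0 = 0.
      apply: (delta_antiderivative_eq0 Tcl hub ht0 htf (FPQ 1 1 v v^T 0 0)) => //.
        move=> s Ts ss; rewrite Mnorm mxE sumr_ge0 // => i _.
        by rewrite mxE -expr2 sqr_ge0.
      apply/eqP; rewrite eq_sym -subr_eq0; apply/eqP.
      have := congr1 (fun Z => (v *m Z) 0 0) Gv.
      by rewrite mulmx0 mulmxBl mulmxBr !mulmxA !mxE.
    rewrite Mnorm -/w mxE => /eqP; rewrite psumr_eq0 => [/allP w0|i _].
      apply/matrixP => i j; rewrite ord1 [RHS]mxE; have := w0 i (mem_index_enum _).
      by rewrite mxE mulf_eq0 orbb => /eqP.
    by rewrite mxE -expr2 sqr_ge0.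
  (* The initial states [v^T] and [0] both give the zero response on [[t0, tf[], so observability
     identifies them. *)
  apply: trmx_inj; rewrite trmx0.
  apply: (obs v^T 0 _ _ _ _ (sys v^T) (sys 0)) => t Tt tt.
  by rewrite CX0 // !mulmx0.
pose z := x0 - x0'.
(* By uniqueness each state is [X t] times its initial value, so equal responses subtract to
   zero. *)
have Cz t : T t -> t0 <= t < tf -> C t *m (X t *m z) = 0.
  move=> Tt tt; rewrite /z mulmxBr -xt0 -xt0' -!XZ // mulmxBr -yx // -yx' //.
  by rewrite yy' // subrr.
have : (F tf - F t0) *m z = 0.
  (* The entries of [F t *m z] have derivative zero on [[t0, tf[], hence equal values at both
     ends. *)
  apply/matrixP => i j; rewrite mulmxBl [RHS]mxE mxE [X in _ + X]mxE.
  apply/eqP; rewrite subr_eq0 eq_sym; apply/eqP.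
  have := delta_antiderivative_eq Tcl hub ht0 htf (ltW h0f) (FPQ _ _ 1%:M z i j).
  rewrite !mul1mx; apply => t Tt tt.
  by rewrite mul1mx /M -!mulmxA Cz // !mulmx0 mxE.
move=> /(congr1 (mulmx (invmx (F tf - F t0)))); rewrite mulKmx // mulmx0.
by move=> /eqP; rewrite subr_eq0 => /eqP.
Qed.
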